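(* Let $\lambda>0$ and $\alpha,\beta\in(0,\infty)$. For each $l\in\mathbb{Z}$ let $\phi_l$ be a non-zero function in $L^2(\mathbb{R},dx)$ such that the support of each $\widehat{\phi_l}$ is contained in an interval of length $\lambda$, and let $q^{(l)}=\frac1\lambda$. Then $\{T_{nq^{(l)}}\phi_l\}_{n,l\in\mathbb{Z}}$ is a nonstationary frame of translates for $L^2(\mathbb{R},dx)$ with frame bounds $\alpha,\beta$ if and only if $$\frac{\alpha}{\lambda}\le\sum_{l\in\mathbb{Z}}|\widehat{\phi_l}(\gamma)|^2\le\frac{\beta}{\lambda}\quad\text{for almost all }\gamma\in\mathbb{R}.$$
   Context: The Fourier transform is $\widehat f(\gamma)=\int_{\mathbb{R}}f(x)e^{-2\pi i x\gamma}\,dx$, and $T_af(x)=f(x-a)$ is translation by $a\in\mathbb{R}$. A countable family $\{\varphi_k\}_{k}$ in a separable Hilbert space $\mathcal H$ is a frame for $\mathcal H$ with (not necessarily optimal) frame bounds $\alpha,\beta\in(0,\infty)$ if $\alpha\|f\|^2\le\sum_k|\langle f,\varphi_k\rangle|^2\le\beta\|f\|^2$ for all $f\in\mathcal H$. A nonstationary frame of translates is a frame for $L^2(\mathbb{R},dx)$ of the form $\{T_{nq^{(l)}}\phi_l\}_{n,l\in\mathbb{Z}}$ (one window function $\phi_l$ for each $l$). *)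

(* Defs.v *)
From HB Require Import structures.
From mathcomp Require Import all_boot all_order all_algebra.
From mathcomp Require Import all_classical all_reals all_analysis.
From mathcomp Require Export complex.

Set Implicit Arguments.
Unset Strict Implicit.
Unset Printing Implicit Defensive.

Import Order.TTheory GRing.Theory Num.Theory.
Import numFieldNormedType.Exports.

Local Open Scope classical_set_scope.
Local Open Scope ring_scope.
Local Open Scope complex_scope.

Section L2_fourier.
Context {R : realType}.
Local Notation mu := (@lebesgue_measure R).
Implicit Types (f g h : R -> R[i]) (a x gamma : R).

Definition cmod (z : R[i]) : R := Normc.normc z.

Definition cmeasurable f : Prop :=
  measurable_fun [set: R] (fun x => complex.Re (f x)) /\
  measurable_fun [set: R] (fun x => complex.Im (f x)).

Definition cintegral f : R[i] :=
  (\int[mu]_(x in [set: R]) complex.Re (f x)) +i*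
  (\int[mu]_(x in [set: R]) complex.Im (f x)).

Definition L2normsq f : \bar R :=
  (\int[mu]_(x in [set: R]) ((cmod (f x)) ^+ 2)%:E)%E.

(* Elements of L^2(R, dx) are represented by functions; two functions that
   agree almost everywhere represent the same element. *)
Definition inL2 f : Prop := cmeasurable f /\ (L2normsq f < +oo)%E.

Definition L2zero f : Prop := {ae mu, forall x, f x = 0}.

Definition L2inner f g : R[i] := cintegral (fun x => f x * (g x)^*).

Definition translate a f : R -> R[i] := fun x => f (x - a).

Definition cexpi (t : R) : R[i] := cos t +i* sin t.

Definition fourier f : R -> R[i] :=
  fun gamma => cintegral (fun x => f x * cexpi (- (2 * pi * x * gamma))).

Definition truncate (N : nat) f : R -> R[i] :=
  fun x => if `|x| <= N%:R then f x else 0.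

(* On L^2 the integral defining [fourier f] need not converge, so the Fourier
   transform is the limit in L^2 of the transforms of the truncations of f,
   which lie in both L^1 and L^2. *)
Definition is_fourierL2 f g : Prop :=
  inL2 g /\
  (fun N : nat => L2normsq (fun x => fourier (truncate N f) x - g x))
    @ \oo --> 0%E.

(* The limit exists for every f in L^2 (Plancherel) and is unique up to
   equality almost everywhere; [fourierL2 f] is one representative. *)
Definition fourierL2 f : R -> R[i] := xget (fun=> 0) (is_fourierL2 f).

(* Support of an element of L^2: the complement of the largest open set on
   which it vanishes almost everywhere. *)
Definition ess_support f : set R :=
  ~` \bigcup_(U in [set U : set R |
        open U /\ {ae mu, forall x, U x -> f x = 0}]) U.

Definition is_L2_frame (K : countType) (phi : K -> R -> R[i])
    (alpha beta : R) : Prop :=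
  [/\ 0 < alpha, 0 < beta, forall k, inL2 (phi k) &
      forall f, inL2 f ->
        (alpha%:E * L2normsq f
           <= \esum_(k in [set: K]) ((cmod (L2inner f (phi k))) ^+ 2)%:E)%E /\
        (\esum_(k in [set: K]) ((cmod (L2inner f (phi k))) ^+ 2)%:E
           <= beta%:E * L2normsq f)%E].

Definition is_nonstationary_frame_of_translates (q : int -> R)
    (phi : int -> R -> R[i]) (alpha beta : R) : Prop :=
  is_L2_frame
    (fun nl : int * int => translate (nl.1%:~R * q nl.2) (phi nl.2))
    alpha beta.

End L2_fourier.

(* Main.v *)
(** By Plancherel's theorem, <f, T_a phi> is the inner product of the transform
of [f] with [exp (- 2 pi i a gamma)] times the transform of [phi].  For
[a = n / lambda], with the transform of [phi_l] carried by a segment of length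
[lambda], these numbers ([n] in Z) are the Fourier coefficients of
[f^ * conj phi_l^] on that segment, so Parseval's identity and a summation
over [l] turn the frame sum into [lambda * \int |f^|^2 * \sum_l |phi_l^|^2].
The bounds on the fiber sum thus give the frame bounds; conversely, testing
the frame inequality on the functions with transform [1_E], [E] a bounded Borel
set, shows that the sets where the fiber sum exceeds a bound are null.

Completeness of the exponentials on a segment [W]: the bounded functions whose
multiplication preserves their closed span form an algebra closed under bounded
almost everywhere convergence.  It contains the indicators of rays, as limits
of [(1 - u^n)^(2^n)] for a trigonometric polynomial [u] with values in [0, 1],
hence those of all Borel sets.  Plancherel's theorem for a function carried by
a segment of length [L] follows from Parseval's identity applied to its
modulations, averaged over the modulation frequency in [[0, 1 / L[]; the general
case is obtained by truncation and completeness of L^2.  The multiplication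
formula (Fubini) shows that [1_E] is a Fourier transform. *)

Require Import Defs.
From mathcomp Require Import finmap.
From mathcomp Require Import all_boot all_order all_algebra.
From mathcomp Require Import all_classical all_reals all_analysis.
From mathcomp Require Import measurable_realfun ring lra.

Import Order.TTheory GRing.Theory Num.Theory.
Import numFieldNormedType.Exports.
Local Open Scope classical_set_scope.
Local Open Scope ring_scope.
Local Open Scope complex_scope.

#[local] Set Implicit Arguments.
#[local] Unset Strict Implicit.

(** * Complex arithmetic and integrals of complex functions *)

Section complex_arith.
Context {R : realType}.
Implicit Types (z w : R[i]).

(** Parseval's identity on a segment serves twice: in time, on a segment carrying a truncated
    function, it leads to Plancherel's theorem; in frequency, on a segment of length [lambda], it
    evaluates the frame sum. Write [g] and [psi l] for the transforms of [f] and [phi l]. The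
    obstacle is that the second use asks for the product of [g] and the conjugate of [psi l] to be
    square integrable, while a product of two L^2 functions is in general only integrable. Each
    direction overcomes this differently. If the fiber sum is bounded, each of its terms is, so
    [psi l] is essentially bounded. If the frame inequality is given, no pointwise bound on [psi l]
    is at hand, so the boundedness is put on [g]: hence indicators as test transforms, and hence the
    need to exhibit preimages for them. Norms are handled through their squares ([csq], [nsq]),
    which are polynomial in real and imaginary parts; the triangle inequality then carries factors
    2, which is why tolerances are divided by 4. *)

Definition csq z : R := complex.Re z ^+ 2 + complex.Im z ^+ 2.

Lemma cmod_sqr z : cmod z ^+ 2 = csq z.
Proof. by case: z => a b; rewrite /cmod /= sqr_sqrtr // addr_ge0 ?sqr_ge0. Qed.

Lemma csq_ge0 z : 0 <= csq z.
Proof. by rewrite addr_ge0 ?sqr_ge0. Qed.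

Lemma csqM z w : csq (z * w) = csq z * csq w.
Proof. by rewrite -!cmod_sqr /cmod Normc.normcM exprMn. Qed.

Lemma ReD z w : complex.Re (z + w) = complex.Re z + complex.Re w.
Proof. by case: z; case: w. Qed.
Lemma ImD z w : complex.Im (z + w) = complex.Im z + complex.Im w.
Proof. by case: z; case: w. Qed.
Lemma ReN z : complex.Re (- z) = - complex.Re z.
Proof. by case: z. Qed.
Lemma ImN z : complex.Im (- z) = - complex.Im z.
Proof. by case: z. Qed.
Lemma ReM z w : complex.Re (z * w) =
  complex.Re z * complex.Re w - complex.Im z * complex.Im w.
Proof. by case: z; case: w. Qed.
Lemma ImM z w : complex.Im (z * w) =
  complex.Re z * complex.Im w + complex.Im z * complex.Re w.
Proof. by case: z; case: w. Qed.
Lemma ReJ z : complex.Re z^* = complex.Re z.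
Proof. by case: z. Qed.
Lemma ImJ z : complex.Im z^* = - complex.Im z.
Proof. by case: z. Qed.

Lemma ReC (r : R) : complex.Re r%:C = r. Proof. by []. Qed.
Lemma ImC (r : R) : complex.Im r%:C = 0. Proof. by []. Qed.

Definition cpartE := (ReD, ImD, ReN, ImN, ReM, ImM, ReJ, ImJ).

Lemma eq_cpart z w :
  complex.Re z = complex.Re w -> complex.Im z = complex.Im w -> z = w.
Proof. by case: z => a b; case: w => c d /= -> ->. Qed.

Lemma csqJ z : csq z^* = csq z.
Proof. by rewrite /csq !cpartE sqrrN. Qed.

Lemma csqN z : csq (- z) = csq z.
Proof. by rewrite /csq !cpartE !sqrrN. Qed.

Lemma csq0 : csq 0 = 0.
Proof. by rewrite /csq /= expr0n addr0. Qed.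

Lemma csq_real (r : R) : csq r%:C = r ^+ 2.
Proof. by rewrite /csq /= expr0n addr0. Qed.

Lemma csq_eq0 z : csq z = 0 -> z = 0.
Proof.
move=> h; apply: Normc.eq0_normc; apply/eqP.
by rewrite -sqrf_eq0 -/(cmod z) cmod_sqr h.
Qed.

(** Parallelogram law: the gap between the two sides is [csq (z - w)]. *)
Lemma csqD_le z w : csq (z + w) <= 2 * csq z + 2 * csq w.
Proof.
rewrite -subr_ge0 (_ : _ - _ = csq (z - w)) ?csq_ge0//.
by rewrite /csq !cpartE; ring.
Qed.

Lemma cexpiD (s t : R) : cexpi (s + t) = cexpi s * cexpi t.
Proof.
by apply: eq_cpart; rewrite /cexpi !cpartE /= ?cosD ?sinD //; ring.
Qed.

Lemma cexpi0 : cexpi (0 : R) = 1.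
Proof. by rewrite /cexpi cos0 sin0. Qed.

Lemma cexpiJ (t : R) : (cexpi t)^* = cexpi (- t).
Proof. by rewrite /cexpi cosN sinN. Qed.

Lemma csq_cexpi (t : R) : csq (cexpi t) = 1.
Proof. by rewrite /csq /= cos2Dsin2. Qed.

End complex_arith.

Section cintegrable.
Context {R : realType}.
Local Notation mu := (@lebesgue_measure R).

Lemma ae_imp (P Q : R -> Prop) : (forall x, P x -> Q x) ->
  {ae mu, forall x, P x} -> {ae mu, forall x, Q x}.
Proof. by move=> PQ; apply: (@filterS _ _ (ae_filter_ringOfSetsType mu)). Qed.

Lemma eq_integralT (f g : R -> \bar R) : f =1 g ->
  (\int[mu]_x f x = \int[mu]_x g x)%E.
Proof. by move=> fg; apply: eq_integral => x _. Qed.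

Lemma ae_and (P Q : R -> Prop) : {ae mu, forall x, P x} ->
  {ae mu, forall x, Q x} -> {ae mu, forall x, P x /\ Q x}.
Proof. exact: (@filterI _ _ (ae_filter_ringOfSetsType mu)). Qed.

Implicit Types (f g h : R -> R[i]) (c : R[i]).

Lemma cmeasurable_cst c : cmeasurable (fun _ : R => c).
Proof. by split; exact: measurable_cst. Qed.

Lemma cmeasurableD f g : cmeasurable f -> cmeasurable g ->
  cmeasurable (fun x => f x + g x).
Proof.
move=> [f1 f2] [g1 g2]; split.
- by under eq_fun do rewrite ReD; exact: measurable_funD.
- by under eq_fun do rewrite ImD; exact: measurable_funD.
Qed.

Lemma cmeasurableM f g : cmeasurable f -> cmeasurable g ->
  cmeasurable (fun x => f x * g x).
Proof.
move=> [f1 f2] [g1 g2]; split.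
- by under eq_fun do rewrite ReM; apply: measurable_funB; exact: measurable_funM.
- by under eq_fun do rewrite ImM; apply: measurable_funD; exact: measurable_funM.
Qed.

Lemma cmeasurableJ f : cmeasurable f -> cmeasurable (fun x => (f x)^*).
Proof.
move=> [f1 f2]; split.
- by under eq_fun do rewrite ReJ.
- by under eq_fun do rewrite ImJ; exact: measurableT_comp.
Qed.

Lemma cmeasurable_real (u : R -> R) : measurable_fun setT u ->
  cmeasurable (fun x => (u x)%:C).
Proof. by move=> mu_; split => //=; exact: measurable_cst. Qed.

Lemma cmeasurableN f : cmeasurable f -> cmeasurable (fun x => - f x).
Proof.
move=> [f1 f2]; split.
- by under eq_fun do rewrite ReN; exact: measurableT_comp.
- by under eq_fun do rewrite ImN; exact: measurableT_comp.
Qed.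

Lemma cmeasurableB f g : cmeasurable f -> cmeasurable g ->
  cmeasurable (fun x => f x - g x).
Proof. by move=> mf mg; apply: cmeasurableD => //; exact: cmeasurableN. Qed.

Lemma measurable_csq f : cmeasurable f -> measurable_fun setT (fun x => csq (f x)).
Proof.
by move=> [f1 f2]; apply: measurable_funD; exact: measurable_funX.
Qed.

Lemma measurable_cexpi (u : R -> R) : measurable_fun setT u ->
  cmeasurable (fun x => cexpi (u x)).
Proof.
move=> mu_; split => /=.
- by apply: measurableT_comp => //; exact: continuous_measurable_fun (@continuous_cos R).
- by apply: measurableT_comp => //; exact: continuous_measurable_fun (@continuous_sin R).
Qed.

Definition cintegrable f :=
  mu.-integrable setT (EFin \o (fun x => complex.Re (f x))) /\
  mu.-integrable setT (EFin \o (fun x => complex.Im (f x))).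

Lemma cintegralD f g : cintegrable f -> cintegrable g ->
  cintegral (fun x => f x + g x) = cintegral f + cintegral g.
Proof.
move=> [f1 f2] [g1 g2]; rewrite /cintegral; apply: eq_cpart => /=.
- by under eq_Rintegral do rewrite ReD; rewrite RintegralD.
- by under eq_Rintegral do rewrite ImD; rewrite RintegralD.
Qed.

Lemma integrable_RealZ (k : R) (u : R -> R) : mu.-integrable setT (EFin \o u) ->
  mu.-integrable setT (EFin \o (fun x => k * u x)).
Proof.
move=> iu; rewrite (_ : _ \o _ = (fun x => k%:E * (EFin \o u) x)%E).
  exact: integrableZl.
by apply/funext => x /=; rewrite EFinM.
Qed.

Lemma integrable_RealD (u v : R -> R) : mu.-integrable setT (EFin \o u) ->
  mu.-integrable setT (EFin \o v) ->
  mu.-integrable setT (EFin \o (fun x => u x + v x)).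
Proof.
move=> iu iv; rewrite (_ : _ \o _ = (EFin \o u) \+ (EFin \o v))%E.
  exact: integrableD.
by apply/funext => x /=; rewrite EFinD.
Qed.

Lemma cintegralZ c f : cintegrable f ->
  cintegral (fun x => c * f x) = c * cintegral f.
Proof.
move=> [f1 f2]; rewrite /cintegral; apply: eq_cpart; rewrite !cpartE /=.
- under eq_Rintegral do rewrite ReM.
  by rewrite RintegralB ?RintegralZl//; exact: integrable_RealZ.
- under eq_Rintegral do rewrite ImM.
  by rewrite RintegralD ?RintegralZl//; exact: integrable_RealZ.
Qed.

Lemma cintegralJ f : cintegrable f ->
  cintegral (fun x => (f x)^*) = (cintegral f)^*.
Proof.
move=> [f1 f2]; rewrite /cintegral; apply: eq_cpart; rewrite !cpartE /=.
- by under eq_Rintegral do rewrite ReJ.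
- under eq_Rintegral do rewrite ImJ.
  under eq_Rintegral do rewrite -mulN1r.
  by rewrite RintegralZl// mulN1r.
Qed.

Lemma cintegrable_le f (u : R -> R) : cmeasurable f ->
  mu.-integrable setT (EFin \o u) ->
  (forall x, `|complex.Re (f x)| <= u x /\ `|complex.Im (f x)| <= u x) ->
  cintegrable f.
Proof.
move=> [f1 f2] iu fu; split.
- apply: (le_integrable measurableT _ _ iu) => //.
    exact/measurable_EFinP.
  by move=> x _ /=; rewrite lee_fin (le_trans (fu x).1) ?ler_norm.
- apply: (le_integrable measurableT _ _ iu) => //.
    exact/measurable_EFinP.
  by move=> x _ /=; rewrite lee_fin (le_trans (fu x).2) ?ler_norm.
Qed.

Lemma eq_cintegral_ae f g : cmeasurable f -> cmeasurable g ->
  {ae mu, forall x, f x = g x} -> cintegral f = cintegral g.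
Proof.
move=> [f1 f2] [g1 g2] fg; rewrite /cintegral /Rintegral.
congr (fine _ +i* fine _); apply: ae_eq_integral => //; try exact/measurable_EFinP;
by apply: ae_imp fg => x /= ->.
Qed.

End cintegrable.

(** * The inner product of $L^2(R)$ *)

Section L2_space.
Context {R : realType}.
Local Notation mu := (@lebesgue_measure R).
Implicit Types (f g h : R -> R[i]) (c : R[i]).

Lemma L2normsqE f : L2normsq f = (\int[mu]_x (csq (f x))%:E)%E.
Proof. by apply: eq_integral => x _; rewrite cmod_sqr. Qed.

Lemma integrable_csq f : inL2 f -> mu.-integrable setT (EFin \o (fun x => csq (f x))).
Proof.
move=> [mf fi]; apply/integrableP; split.
  by apply/measurable_EFinP; exact: measurable_csq.
rewrite L2normsqE in fi.
by under eq_integral => x _ do rewrite /= ger0_norm ?csq_ge0//.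
Qed.

Lemma inL2_le f (G : R -> R) : cmeasurable f -> mu.-integrable setT (EFin \o G) ->
  (forall x, csq (f x) <= G x) -> inL2 f.
Proof.
move=> mf iG fG; split => //; rewrite L2normsqE.
have/integrableP[mG] := iG; apply: le_lt_trans; apply: ge0_le_integral => //.
- by move=> x _; rewrite lee_fin csq_ge0.
- by apply/measurable_EFinP; exact: measurable_csq.
- exact: measurableT_comp.
- by move=> x _ /=; rewrite lee_fin (le_trans (fG x)) ?ler_norm.
Qed.

Lemma inL2_0 : inL2 (fun _ : R => 0).
Proof.
apply: (@inL2_le _ (fun _ => 0)); first exact: cmeasurable_cst.
  exact: (@integrable0 _ _ _ mu setT).
by move=> x; rewrite csq0.
Qed.

Lemma inL2D f g : inL2 f -> inL2 g -> inL2 (fun x => f x + g x).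
Proof.
move=> f2 g2; apply: (@inL2_le _ (fun x => 2 * csq (f x) + 2 * csq (g x))).
- exact: cmeasurableD f2.1 g2.1.
- by apply: integrable_RealD; apply: integrable_RealZ; exact: integrable_csq.
- by move=> x; exact: csqD_le.
Qed.

Lemma inL2M_bounded (m : R -> R[i]) (K : R) f : cmeasurable m ->
  (forall x, csq (m x) <= K) -> inL2 f -> inL2 (fun x => m x * f x).
Proof.
move=> mm mK f2; apply: (@inL2_le _ (fun x => K * csq (f x))).
- exact: cmeasurableM mm f2.1.
- by apply: integrable_RealZ; exact: integrable_csq.
- by move=> x; rewrite csqM ler_wpM2r ?csq_ge0.
Qed.

Lemma inL2Z c f : inL2 f -> inL2 (fun x => c * f x).
Proof.
by apply: (@inL2M_bounded (fun=> c) (csq c)) => //; exact: cmeasurable_cst.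
Qed.

Lemma inL2B f g : inL2 f -> inL2 g -> inL2 (fun x => f x - g x).
Proof.
move=> f2 /(@inL2Z (-1)) g2; have := inL2D f2 g2.
by under [in X in X -> _]eq_fun do rewrite mulN1r.
Qed.

Lemma inL2_sum (I : Type) (s : seq I) (F : I -> R -> R[i]) :
  (forall i, inL2 (F i)) -> inL2 (fun x => \sum_(i <- s) F i x).
Proof.
move=> F2; elim: s => [|i s ih].
  by under eq_fun do rewrite big_nil; exact: inL2_0.
by under eq_fun do rewrite big_cons; exact: inL2D.
Qed.

Lemma cintegrable_mulJ f g : inL2 f -> inL2 g -> cintegrable (fun x => f x * (g x)^*).
Proof.
move=> f2 g2.
apply: (@cintegrable_le _ _ (fun x => csq (f x) + csq (g x))).
- exact: cmeasurableM f2.1 (cmeasurableJ g2.1).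
- by apply: integrable_RealD; exact: integrable_csq.
- move=> x; rewrite !cpartE /csq.
  move: (f x) (g x) => [a b] [u v] /=.
  (* With the products as atoms, [lra] combines these squares: each one is the inequality between
     arithmetic and geometric means for one product and one sign. *)
  by split; rewrite ler_norml; apply/andP; split;
    have := sqr_ge0 (a + u); have := sqr_ge0 (a - u);
    have := sqr_ge0 (b + v); have := sqr_ge0 (b - v);
    have := sqr_ge0 (a + v); have := sqr_ge0 (a - v);
    have := sqr_ge0 (b + u); have := sqr_ge0 (b - u);
    rewrite !sqrrD !sqrrN ?mulrN; lra.
Qed.

Lemma L2innerDl f g h : inL2 f -> inL2 g -> inL2 h ->
  L2inner (fun x => f x + g x) h = L2inner f h + L2inner g h.
Proof.
move=> f2 g2 h2; rewrite /L2inner -cintegralD; try exact: cintegrable_mulJ.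
by congr cintegral; apply/funext => x; rewrite mulrDl.
Qed.

Lemma L2innerZl c f h : inL2 f -> inL2 h ->
  L2inner (fun x => c * f x) h = c * L2inner f h.
Proof.
move=> f2 h2; rewrite /L2inner -cintegralZ; last exact: cintegrable_mulJ.
by congr cintegral; apply/funext => x; rewrite mulrA.
Qed.

Lemma L2innerJ f g : inL2 f -> inL2 g -> L2inner g f = (L2inner f g)^*.
Proof.
move=> f2 g2; rewrite /L2inner -cintegralJ; last exact: cintegrable_mulJ.
by congr cintegral; apply/funext => x; apply: eq_cpart; rewrite !cpartE; ring.
Qed.

Lemma L2innerDr f g h : inL2 f -> inL2 g -> inL2 h ->
  L2inner h (fun x => f x + g x) = L2inner h f + L2inner h g.
Proof.
move=> f2 g2 h2; rewrite L2innerJ ?L2innerDl//; last exact: inL2D.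
by rewrite (L2innerJ f2 h2) (L2innerJ g2 h2); apply: eq_cpart; rewrite !cpartE//; ring.
Qed.

Lemma L2innerZr c f h : inL2 f -> inL2 h ->
  L2inner h (fun x => c * f x) = c^* * L2inner h f.
Proof.
move=> f2 h2; rewrite L2innerJ ?L2innerZl//; last exact: inL2Z.
by rewrite (L2innerJ f2 h2); apply: eq_cpart; rewrite !cpartE; ring.
Qed.

Lemma L2innerBl f g h : inL2 f -> inL2 g -> inL2 h ->
  L2inner (fun x => f x - g x) h = L2inner f h - L2inner g h.
Proof.
move=> f2 g2 h2; under [in LHS]eq_fun do rewrite -mulN1r.
by rewrite L2innerDl// ?L2innerZl// ?mulN1r//; exact: inL2Z.
Qed.

Lemma L2inner0l h : inL2 h -> L2inner (fun=> 0) h = 0.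
Proof.
move=> h2; rewrite -[RHS](mul0r (L2inner h h)) -L2innerZl//.
by congr L2inner; apply/funext => x; rewrite mul0r.
Qed.

Lemma L2inner_suml (I : Type) (s : seq I) (F : I -> R -> R[i]) h :
  (forall i, inL2 (F i)) -> inL2 h ->
  L2inner (fun x => \sum_(i <- s) F i x) h = \sum_(i <- s) L2inner (F i) h.
Proof.
move=> F2 h2; elim: s => [|i s ih].
  by rewrite big_nil; under eq_fun do rewrite big_nil; rewrite L2inner0l.
rewrite big_cons; under eq_fun do rewrite big_cons.
by rewrite L2innerDl ?ih//; exact: inL2_sum.
Qed.

(* The junk value [0] is taken when [L2normsq f] is infinite. *)
Definition nsq f : R := fine (L2normsq f).

Lemma nsq_ge0 f : 0 <= nsq f.
Proof. by rewrite fine_ge0// L2normsqE integral_ge0// => x _; rewrite lee_fin csq_ge0. Qed.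

Lemma L2normsq_nsq f : inL2 f -> L2normsq f = (nsq f)%:E.
Proof.
move=> [_ f2]; rewrite fineK// ge0_fin_numE//.
by rewrite L2normsqE integral_ge0// => x _; rewrite lee_fin csq_ge0.
Qed.

Lemma L2inner_self f : inL2 f -> L2inner f f = (nsq f)%:C.
Proof.
move=> f2; rewrite /L2inner /cintegral /nsq L2normsqE; apply: eq_cpart => /=.
  by rewrite /Rintegral; congr fine; apply: eq_integral => x _;
    rewrite !cpartE /csq; congr EFin; ring.
rewrite /Rintegral (@eq_integralT _ _ (cst 0%E)) ?integral0// => x.
by rewrite !cpartE /=; congr EFin; ring.
Qed.

Lemma eq_nsq f g : (forall x, csq (f x) = csq (g x)) -> nsq f = nsq g.
Proof.
by move=> fg; rewrite /nsq !L2normsqE; congr fine; apply: eq_integral => x _;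
  rewrite fg.
Qed.

Lemma nsqZ c f : inL2 f -> nsq (fun x => c * f x) = csq c * nsq f.
Proof.
move=> f2.
have: (nsq (fun x => c * f x))%:C = c * (c^* * (nsq f)%:C).
  rewrite -L2inner_self; last exact: inL2Z.
  by rewrite L2innerZl ?L2innerZr ?L2inner_self//; exact: inL2Z.
by move=> /(congr1 (@complex.Re R)); rewrite !cpartE /= /csq => ->; ring.
Qed.

Lemma nsqD f g : inL2 f -> inL2 g ->
  nsq (fun x => f x + g x) = nsq f + nsq g + 2 * complex.Re (L2inner f g).
Proof.
move=> f2 g2; have fg2 := inL2D f2 g2.
have := L2inner_self fg2.
rewrite L2innerDl ?L2innerDr// (L2innerJ f2 g2) !L2inner_self//.
by move=> /(congr1 (@complex.Re R)); rewrite !cpartE /= => <-; ring.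
Qed.

Lemma nsqB f g : inL2 f -> inL2 g ->
  nsq (fun x => f x - g x) = nsq f + nsq g - 2 * complex.Re (L2inner f g).
Proof.
move=> f2 g2; under [in LHS]eq_fun do rewrite -mulN1r.
rewrite nsqD ?nsqZ// ?L2innerZr//; try exact: inL2Z.
by rewrite !cpartE /= csqN /csq /=; ring.
Qed.

Lemma nsqD_le f g : inL2 f -> inL2 g ->
  nsq (fun x => f x + g x) <= 2 * nsq f + 2 * nsq g.
Proof.
move=> f2 g2; have := nsqB f2 g2; rewrite (nsqD f2 g2).
by have := nsq_ge0 (fun x => f x - g x); lra.
Qed.

Lemma nsqBC f g : nsq (fun x => f x - g x) = nsq (fun x => g x - f x).
Proof. by apply: eq_nsq => x; rewrite -opprB csqN. Qed.

Lemma nsq_triangle f g h : inL2 f -> inL2 g -> inL2 h ->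
  nsq (fun x => f x - h x) <= 2 * nsq (fun x => f x - g x) + 2 * nsq (fun x => g x - h x).
Proof.
move=> f2 g2 h2; rewrite (_ : (fun x => f x - h x) = fun x => (f x - g x) + (g x - h x)).
  by apply: nsqD_le; exact: inL2B.
by apply/funext => x; rewrite addrA subrK.
Qed.

Lemma L2_CauchySchwarz f g : inL2 f -> inL2 g ->
  csq (L2inner f g) <= nsq f * nsq g.
Proof.
move=> f2 g2; set c := L2inner f g.
(* In the direction [c * g], with [c] the inner product itself, the cross term is the real number
   [s * csq c], so a quadratic polynomial in a real variable suffices. *)
have key (s : R) : 0 <= nsq f + 2 * s * csq c + s ^+ 2 * csq c * nsq g.
  have := nsq_ge0 (fun x => f x + (s%:C * c) * g x).
  rewrite nsqD//; last exact: inL2Z.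
  rewrite nsqZ// L2innerZr// -/c csqM csq_real !cpartE ReC ImC => h.
  apply: (le_trans h); rewrite le_eqVlt; apply/orP; left; apply/eqP.
  rewrite /csq; ring.
have [g0|g0] := ltP 0 (nsq g).
  (* The minimiser of the quadratic. *)
  have := key (- (nsq g)^-1).
  rewrite -ler_pdivrMr//.
  have -> : nsq f + 2 * - (nsq g)^-1 * csq c + (- (nsq g)^-1) ^+ 2 * csq c * nsq g =
    nsq f - csq c / nsq g by field; rewrite gt_eqF.
  by rewrite subr_ge0.
have {g0} g0 : nsq g = 0 by apply/eqP; rewrite eq_le g0 nsq_ge0.
rewrite g0 mulr0; rewrite leNgt; apply/negP => c0.
(* With [nsq g = 0] the polynomial is affine in [s]; at this point it equals -1. *)
have := key (- (nsq f + 1) / (2 * csq c)); rewrite g0 mulr0 addr0.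
have -> : 2 * (- (nsq f + 1) / (2 * csq c)) * csq c = - (nsq f + 1).
  by field; rewrite gt_eqF.
by lra.
Qed.

End L2_space.

(** * Convergence in L^2 *)

Section L2_convergence.
Context {R : realType}.
Local Notation mu := (@lebesgue_measure R).
Implicit Types (f g h : R -> R[i]) (c : R[i]).

Lemma L2normsq_cvg0 (d : nat -> R -> R[i]) : (forall n, inL2 (d n)) ->
  (fun n => L2normsq (d n)) @ \oo --> 0%E <-> (fun n => nsq (d n)) @ \oo --> (0 : R).
Proof.
move=> d2; rewrite (_ : (fun n => L2normsq (d n)) = EFin \o (fun n => nsq (d n))).
  by split => [/fine_cvgP[_]|h] //; apply: cvg_EFin => //; exact: nearW.
by apply/funext => n /=; rewrite L2normsq_nsq.
Qed.

Lemma L2_dominated (d : nat -> R -> R[i]) (G : R -> R) :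
  (forall n, cmeasurable (d n)) -> mu.-integrable setT (EFin \o G) ->
  (forall n x, csq (d n x) <= G x) ->
  {ae mu, forall x, (fun n => csq (d n x)) @ \oo --> (0 : R)} ->
  (fun n => nsq (d n)) @ \oo --> (0 : R).
Proof.
move=> md iG dG d0; have d2 n : inL2 (d n) by exact: inL2_le (md n) iG (dG n).
apply/L2normsq_cvg0 => //; under eq_fun do rewrite L2normsqE.
have [] := @dominated_convergence _ _ R mu setT measurableT
  (fun n x => (csq (d n x))%:E) (cst 0%E) (EFin \o G).
- by move=> n; apply/measurable_EFinP; exact: measurable_csq.
- exact: measurable_cst.
- by apply: ae_imp d0 => x h _; apply: cvg_EFin => //; exact: nearW.
- exact: iG.
- by apply: aeW => x n _; rewrite /= lee_fin ger0_norm ?csq_ge0.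
- by move=> _ _; rewrite integral0.
Qed.

Lemma EFin_cvgn (v : nat -> R) (l : R) :
  (fun n => (v n)%:E) @ \oo --> l%:E -> v @ \oo --> l.
Proof. by move=> /fine_cvgP[]. Qed.

Lemma cvg_squeeze0 (u v : nat -> R) : (forall n, 0 <= u n <= v n) ->
  v @ \oo --> (0 : R) -> u @ \oo --> (0 : R).
Proof.
move=> uv v0; apply: (@squeeze_cvgr _ _ _ _ (cst 0) v) => //.
- by apply: nearW => n; exact: uv.
- exact: cvg_cst.
Qed.

(** The difference splits into the inner product of [f_ n - f] with [g_ n] and that of [f] with
    [g_ n - g]; in the first, the squared norm of [g_ n] is controlled by those of [g_ n - g] and
    [g]. *)
Lemma L2inner_cvg (f_ g_ : nat -> R -> R[i]) f g :
  (forall n, inL2 (f_ n)) -> (forall n, inL2 (g_ n)) -> inL2 f -> inL2 g ->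
  (fun n => nsq (fun x => f_ n x - f x)) @ \oo --> (0 : R) ->
  (fun n => nsq (fun x => g_ n x - g x)) @ \oo --> (0 : R) ->
  (fun n => csq (L2inner (f_ n) (g_ n) - L2inner f g)) @ \oo --> (0 : R).
Proof.
move=> fn2 gn2 f2 g2 cf cg.
apply: (@cvg_squeeze0 _ (fun n => 2 * (nsq (fun x => f_ n x - f x) *
   (2 * nsq (fun x => g_ n x - g x) + 2 * nsq g)) +
   2 * (nsq f * nsq (fun x => g_ n x - g x)))).
  move=> n; rewrite csq_ge0 /=.
  have dgn := inL2B (gn2 n) g2; have dfn := inL2B (fn2 n) f2.
  have -> : L2inner (f_ n) (g_ n) - L2inner f g =
     L2inner (fun x => f_ n x - f x) (g_ n) + L2inner f (fun x => g_ n x - g x).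
    rewrite L2innerBl// (L2innerJ (inL2B (gn2 n) g2) f2) L2innerBl//.
    rewrite (L2innerJ f2 (gn2 n)) (L2innerJ f2 g2).
    by apply: eq_cpart; rewrite !cpartE; ring.
  apply: (le_trans (csqD_le _ _)); apply: lerD; rewrite ler_pM2l//.
    apply: (le_trans (L2_CauchySchwarz _ _)) => //.
    apply: ler_wpM2l; first exact: nsq_ge0.
    have := nsqD_le dgn g2.
    by under [in X in X -> _]eq_fun do rewrite subrK.
  exact: L2_CauchySchwarz.
rewrite (_ : 0 = 2 * (0 * (2 * 0 + 2 * nsq g)) + 2 * (nsq f * 0)); last by ring.
apply: cvgD; apply: cvgMr; last exact: cvgMr.
by apply: cvgM => //; apply: cvgD; [exact: cvgMr|exact: cvg_cst].
Qed.

Lemma csq_cvg_unique (z_ : nat -> R[i]) (z w : R[i]) :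
  (fun n => csq (z_ n - z)) @ \oo --> (0 : R) ->
  (fun n => csq (z_ n - w)) @ \oo --> (0 : R) -> z = w.
Proof.
move=> zz zw; apply/eqP; rewrite -subr_eq0; apply/eqP/csq_eq0.
have : (fun n : nat => csq (z - w)) @ \oo --> (0 : R).
  apply: (@cvg_squeeze0 _ (fun n => 2 * csq (z_ n - z) + 2 * csq (z_ n - w))).
    move=> n; rewrite csq_ge0 /= -(csqN (z_ n - z)).
    rewrite (_ : z - w = - (z_ n - z) + (z_ n - w)) ?csqD_le//.
    by rewrite opprB addrA subrK.
  rewrite (_ : 0 = 2 * 0 + 2 * 0); last by ring.
  by apply: cvgD; exact: cvgMr.
by move=> h; apply: (cvg_unique _ (cvg_cst _) h) => //.
Qed.

End L2_convergence.

(** * Trigonometric polynomials on a segment *)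

Section trigonometric_span.
Context {R : realType}.
Local Notation mu := (@lebesgue_measure R).
Context (a lam : R) (lam_gt0 : 0 < lam).
Implicit Types (f g h : R -> R[i]) (c : R[i]).

Local Notation W := (`[a, a + lam]%classic : set R).

Definition chr (t x : R) : R[i] := cexpi (2 * pi * x * t).

(** The cut-off makes the exponential an element of L^2(R): L^2 of the segment is treated as the
    subspace of functions vanishing off [W], with the same integral. *)
Definition chrW (n : int) (x : R) : R[i] := (\1_W x)%:C * chr (n%:~R / lam) x.

Lemma chrWE n x : chrW n x = (\1_W x)%:C * chr (n%:~R / lam) x.
Proof. by []. Qed.

Lemma csq_chr t x : csq (chr t x) = 1.
Proof. exact: csq_cexpi. Qed.

Lemma chrD s t x : chr (s + t) x = chr s x * chr t x.
Proof. by rewrite /chr mulrDr cexpiD. Qed.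

Lemma cmeasurable_chr t : cmeasurable (chr t).
Proof.
by apply: measurable_cexpi; apply: measurable_funM => //; exact: measurable_funM.
Qed.

Lemma measurable_W : measurable W.
Proof. exact: measurable_itv. Qed.

Lemma inL2_indic (E : set R) : measurable E -> (mu E < +oo)%E ->
  inL2 (fun x => (\1_E x)%:C : R[i]).
Proof.
move=> mE Efin; split; first by apply: cmeasurable_real; exact: measurable_indic.
rewrite L2normsqE (@eq_integralT _ _ (fun x => (\1_E x)%:E)).
  by rewrite integral_indic ?setIT.
by move=> x; rewrite csq_real indicE; case: (x \in E); rewrite ?expr1n ?expr0n.
Qed.

Lemma mu_W : mu W = lam%:E.
Proof. by rewrite lebesgue_measure_itv /= lte_fin ltrDl lam_gt0 -EFinD addrAC subrr add0r. Qed.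

Lemma inL2_chrW n : inL2 (chrW n).
Proof.
rewrite /chrW; under eq_fun do rewrite mulrC.
apply: (@inL2M_bounded _ _ 1); first exact: cmeasurable_chr.
  by move=> x; rewrite csq_chr.
by apply: inL2_indic; [exact: measurable_W|rewrite mu_W ltry].
Qed.

Lemma chrW_shift m n x : chr (m%:~R / lam) x * chrW n x = chrW (m + n) x.
Proof. by rewrite /chrW intrD mulrDl chrD; ring. Qed.

Definition trigsum (s : seq int) (k : int -> R[i]) (x : R) : R[i] :=
  \sum_(n <- s) k n * chrW n x.

Lemma inL2_trigsum s k : inL2 (trigsum s k).
Proof. by apply: inL2_sum => n; apply: inL2Z; exact: inL2_chrW. Qed.

(** Padding with zero coefficients: two sums over different lists of frequencies are added over a
    common list. *)
Lemma trigsum_widen s t k : uniq s -> uniq t -> {subset s <= t} ->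
  trigsum s k = trigsum t (fun n => if n \in s then k n else 0).
Proof.
move=> us ut st; apply/funext => x; rewrite /trigsum.
rewrite [RHS](bigID (fun n => n \in s)) /= [X in _ + X]big1 ?addr0; last first.
  by move=> n /negbTE ->; rewrite mul0r.
rewrite -[RHS]big_filter.
under [RHS]eq_big_seq => n do rewrite mem_filter => /andP[-> _].
apply: perm_big; apply: uniq_perm => //; first exact: filter_uniq.
by move=> n; rewrite mem_filter; case: (boolP (n \in s)) => // /st ->.
Qed.

Lemma trigsumD s k t l : uniq s -> uniq t -> exists2 q : seq int * (int -> R[i]),
  uniq q.1 & forall x, trigsum s k x + trigsum t l x = trigsum q.1 q.2 x.
Proof.
move=> us ut; pose q := undup (s ++ t).
exists (q, fun n => (if n \in s then k n else 0) + (if n \in t then l n else 0)).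
  exact: undup_uniq.
move=> x; rewrite (@trigsum_widen s q) ?undup_uniq//; last first.
  by move=> n ns; rewrite mem_undup mem_cat ns.
rewrite (@trigsum_widen t q) ?undup_uniq//; last first.
  by move=> n ns; rewrite mem_undup mem_cat ns orbT.
by rewrite /trigsum -big_split /=; apply: eq_bigr => n _; rewrite mulrDl.
Qed.

(** The closed linear span of the [chrW n]. Frequencies are listed without repetition so that
    orthogonality gives the squared norm of a sum as [lam] times the sum of the squared
    coefficients. *)
Definition trigspan f := [/\ inL2 f, (forall x, ~ W x -> f x = 0) &
  forall eps : R, 0 < eps -> exists2 q : seq int * (int -> R[i]),
    uniq q.1 & nsq (fun x => f x - trigsum q.1 q.2 x) < eps].

Lemma trigspan_chrW n : trigspan (chrW n).
Proof.
split; first exact: inL2_chrW.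
  by move=> x Wx; rewrite /chrW indicE memNset// mul0r.
move=> e e0; exists ([:: n], fun=> 1) => //=.
rewrite (@eq_nsq _ _ (fun=> 0)); last first.
  by move=> x; rewrite /trigsum big_seq1 mul1r subrr.
by rewrite /nsq L2normsqE (@eq_integralT _ _ (cst 0%E)) ?integral0// => x; rewrite csq0.
Qed.

Lemma trigspanD f g : trigspan f -> trigspan g -> trigspan (fun x => f x + g x).
Proof.
move=> [f2 f0 fs] [g2 g0 gs]; split; first exact: inL2D.
  by move=> x Wx; rewrite f0// g0// addr0.
move=> e e0; have e4 : 0 < e / 4 by lra.
have [[s k] /= us fe] := fs _ e4; have [[t l] /= ut ge_] := gs _ e4.
have [q uq qE] := trigsumD k l us ut; exists q => //.
rewrite (@eq_nsq _ _ (fun x => (f x - trigsum s k x) + (g x - trigsum t l x))); last first.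
  by move=> x; rewrite -qE; congr csq; ring.
apply: le_lt_trans (nsqD_le _ _) _; try by apply: inL2B => //; exact: inL2_trigsum.
by lra.
Qed.

Lemma trigsumZ s k c x : c * trigsum s k x = trigsum s (fun n => c * k n) x.
Proof. by rewrite /trigsum mulr_sumr; apply: eq_bigr => n _; rewrite mulrA. Qed.

Lemma trigspanZ c f : trigspan f -> trigspan (fun x => c * f x).
Proof.
move=> [f2 f0 fs]; split; first exact: inL2Z.
  by move=> x Wx; rewrite f0// mulr0.
move=> e e0; have c1 : 0 < csq c + 1 by rewrite ltr_wpDl ?csq_ge0.
have [[s k] /= us fe] := fs _ (divr_gt0 e0 c1).
exists (s, fun n => c * k n) => //=.
rewrite (@eq_nsq _ _ (fun x => c * (f x - trigsum s k x))); last first.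
  by move=> x; rewrite mulrBr trigsumZ.
rewrite nsqZ; last by apply: inL2B => //; exact: inL2_trigsum.
move: fe; rewrite ltr_pdivlMr// => fe; apply: le_lt_trans fe.
by rewrite mulrC ler_wpM2l ?nsq_ge0// lerDl.
Qed.

Lemma trigspan_lim (f_ : nat -> R -> R[i]) f : (forall n, trigspan (f_ n)) ->
  inL2 f -> (forall x, ~ W x -> f x = 0) ->
  (fun n => nsq (fun x => f_ n x - f x)) @ \oo --> (0 : R) -> trigspan f.
Proof.
move=> fs f2 f0 cf; split => // e e0; have e4 : 0 < e / 4 by lra.
have /cvgrPdist_lt/(_ _ e4)[n _ /(_ n (leqnn n))] := cf.
rewrite sub0r normrN ger0_norm ?nsq_ge0// => fn.
have [fn2 _ fns] := fs n; have [q uq qe] := fns _ e4; exists q => //.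
apply: le_lt_trans (nsq_triangle f2 fn2 (inL2_trigsum _ _)) _.
by rewrite nsqBC; lra.
Qed.

Lemma trigspan_chr m f : trigspan f -> trigspan (fun x => chr (m%:~R / lam) x * f x).
Proof.
move=> [f2 f0 fs]; split.
- apply: (@inL2M_bounded _ _ 1) => //; first exact: cmeasurable_chr.
  by move=> x; rewrite csq_chr.
- by move=> x Wx; rewrite f0// mulr0.
move=> e e0; have [[s k] /= us fe] := fs _ e0.
exists ([seq m + n | n <- s], fun n => k (n - m)) => /=.
  by rewrite map_inj_uniq//; exact: addrI.
rewrite (@eq_nsq _ _ (fun x => f x - trigsum s k x))// => x.
have -> : csq (f x - trigsum s k x) =
    csq (chr (m%:~R / lam) x * (f x - trigsum s k x)) by rewrite csqM csq_chr mul1r.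
rewrite mulrBr; congr (csq (_ - _)).
rewrite /trigsum big_map mulr_sumr; apply: eq_bigr => n _ /=.
by rewrite -chrW_shift [m + n]addrC addrK mulrCA.
Qed.

End trigonometric_span.

(** * Multipliers of the closed span and polynomial approximation of a step *)

Section trigonometric_multipliers.
Context {R : realType}.
Local Notation mu := (@lebesgue_measure R).
Context (a lam : R) (lam_gt0 : 0 < lam).
Implicit Types (f g h m : R -> R[i]) (c : R[i]).

Local Notation W := (`[a, a + lam]%classic : set R).
Local Notation trigspan := (trigspan a lam).

(** Multipliers are stable under products, which square integrable functions are not; applied to
    [chrW 0], the indicator of [W], a multiplier yields an element of the closed span. The bound
    keeps the product in L^2. *)
Definition trigmult m := [/\ cmeasurable m, exists K, forall x, csq (m x) <= K &
  forall f, trigspan f -> trigspan (fun x => m x * f x)].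

Lemma trigmult_cst c : trigmult (fun=> c).
Proof.
split; [exact: cmeasurable_cst|by exists (csq c)|].
by move=> f; exact: trigspanZ.
Qed.

Lemma trigmult_chr n : trigmult (chr (n%:~R / lam)).
Proof.
split; [exact: cmeasurable_chr|by exists 1 => x; rewrite csq_chr|].
by move=> f; exact: trigspan_chr.
Qed.

Lemma trigmultD m1 m2 : trigmult m1 -> trigmult m2 -> trigmult (fun x => m1 x + m2 x).
Proof.
move=> [m1m [K1 m1K] h1] [m2m [K2 m2K] h2]; split; first exact: cmeasurableD.
  exists (2 * K1 + 2 * K2) => x; apply: (le_trans (csqD_le _ _)).
  by apply: lerD; rewrite ler_pM2l.
move=> f fs; rewrite (_ : (fun x => _) = (fun x => m1 x * f x + m2 x * f x)).
  by apply: trigspanD => //; [exact: h1|exact: h2].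
by apply/funext => x; rewrite mulrDl.
Qed.

Lemma trigmultM m1 m2 : trigmult m1 -> trigmult m2 -> trigmult (fun x => m1 x * m2 x).
Proof.
move=> [m1m [K1 m1K] h1] [m2m [K2 m2K] h2]; split; first exact: cmeasurableM.
  exists (K1 * K2) => x; rewrite csqM ler_pM ?csq_ge0//.
move=> f fs; rewrite (_ : (fun x => _) = (fun x => m1 x * (m2 x * f x))).
  by apply: h1; exact: h2.
by apply/funext => x; rewrite mulrA.
Qed.

Lemma trigmultX m k : trigmult m -> trigmult (fun x => m x ^+ k).
Proof.
move=> mm; elim: k => [|k ih].
  by under eq_fun do rewrite expr0; exact: trigmult_cst.
by under eq_fun do rewrite exprS; exact: trigmultM.
Qed.

Lemma trigmult_lim (m_ : nat -> R -> R[i]) m (K : R) : (forall n, trigmult (m_ n)) ->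
  cmeasurable m -> (forall n x, csq (m_ n x) <= K) -> (forall x, csq (m x) <= K) ->
  {ae mu, forall x, W x -> (fun n => csq (m_ n x - m x)) @ \oo --> (0 : R)} ->
  trigmult m.
Proof.
move=> mn mm mnK mK cm; split => //; first by exists K.
move=> f fs; have [f2 f0 _] := fs.
have mf2 : inL2 (fun x => m x * f x) by exact: inL2M_bounded mm mK f2.
apply: (@trigspan_lim _ _ _ lam_gt0 (fun n x => m_ n x * f x)) => //.
- by move=> n; have [_ _] := mn n; exact.
- by move=> x Wx; rewrite f0// mulr0.
under eq_fun do under eq_fun do rewrite -mulrBl.
(* The constant is [2 * K + 2 * K], from the bound on the squared modulus of a difference. *)
apply: (@L2_dominated _ _ (fun x => (4 * K) * csq (f x))).
- move=> n; apply: cmeasurableM f2.1; apply: cmeasurableB => //.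
  by have [] := mn n.
- by apply: integrable_RealZ; exact: integrable_csq.
- move=> n x; rewrite csqM ler_wpM2r ?csq_ge0//.
  apply: (le_trans (csqD_le _ _)); rewrite csqN.
  by have := mnK n x; have := mK x; lra.
apply: ae_imp cm => x.
have [Wx|Wx] := pselect (W x) => h; last first.
  by under eq_fun do rewrite f0// mulr0 csq0; exact: cvg_cst.
under eq_fun do rewrite csqM.
by rewrite -(mul0r (csq (f x))); apply: cvgM; [exact: h|exact: cvg_cst].
Qed.

(* The polynomials [(1 - u^n)^(2^n)] converge on [0, 1] to the indicator of
   [u < 1/2], away from [u = 1/2]. *)
Lemma bernoulli_pow (t : R) k : 0 <= t <= 1 -> 1 - k%:R * t <= (1 - t) ^+ k.
Proof.
move=> /andP[t0 t1]; elim: k => [|k ih]; first by rewrite mul0r subr0 expr0.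
rewrite exprS.
apply: le_trans (_ : (1 - t) * (1 - k%:R * t) <= _); last by rewrite ler_wpM2l// subr_ge0.
have : 0 <= k%:R * t * t by rewrite !mulr_ge0.
by rewrite -[k.+1]addn1 natrD; lra.
Qed.

Definition steppoly (u : R) (n : nat) : R := (1 - u ^+ n) ^+ (2 ^ n).

Lemma steppoly_itv u n : 0 <= u <= 1 -> 0 <= steppoly u n <= 1.
Proof.
move=> /andP[u0 u1]; have un : 0 <= 1 - u ^+ n <= 1.
  by rewrite subr_ge0 exprn_ile1//= gerBl exprn_ge0.
by rewrite /steppoly exprn_ge0 ?exprn_ile1//; case/andP: un.
Qed.

(** Bernoulli's inequality bounds the polynomial below by [1 - (2 * u) ^+ n]; the exponent [2 ^ n]
    places the threshold at 1/2. *)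
Lemma steppoly_cvg1 u : 0 <= u < 1 / 2 -> steppoly u @ \oo --> (1 : R).
Proof.
move=> /andP[u0 u12]; have u1 : 0 <= u <= 1 by rewrite u0; lra.
apply: (@squeeze_cvgr _ _ _ _ (fun n => 1 - (2 * u) ^+ n) (cst 1)).
- apply: nearW => n; case/andP: (steppoly_itv n u1) => _ -> /=; rewrite andbT.
  rewrite exprMn -natrX; apply: bernoulli_pow.
  by rewrite exprn_ge0//= exprn_ile1//; case/andP: u1.
- rewrite -[X in _ --> X]subr0; apply: cvgB; first exact: cvg_cst.
  by apply: cvg_expr; rewrite ger0_norm; lra.
- exact: cvg_cst.
Qed.

(** With [t = u ^+ n] and [k = 2 ^ n], the product of [(1 - t) ^+ k] and [(1 + t) ^+ k] is at most
    1, and the second factor is at least [1 + k * t], hence at least [(2 * u) ^+ n], which tends to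
    infinity. *)
Lemma steppoly_cvg0 u : 1 / 2 < u <= 1 -> steppoly u @ \oo --> (0 : R).
Proof.
move=> /andP[u12 u1]; have u01 : 0 <= u <= 1 by rewrite u1 andbT; lra.
have u0 : 0 <= u by case/andP: u01.
apply: (@cvg_squeeze0 _ _ (fun n => ((2 * u)^-1) ^+ n)) => [n|]; last first.
  apply: cvg_expr; rewrite ger0_norm ?invr_ge0; last lra.
  by rewrite invf_lt1; lra.
case/andP: (steppoly_itv n u01) => -> _ /=.
have un0 : 0 <= u ^+ n by rewrite exprn_ge0.
have un1 : u ^+ n <= 1 by rewrite exprn_ile1.
have u2n : 0 < (2 * u) ^+ n by rewrite exprn_gt0//; lra.
rewrite exprVn -[leRHS]div1r ler_pdivlMr//.
apply: (@le_trans _ _ (steppoly u n * (1 + u ^+ n) ^+ (2 ^ n))).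
  apply: ler_wpM2l; first by case/andP: (steppoly_itv n u01).
  apply: (@le_trans _ _ (1 + (2 ^ n)%:R * u ^+ n)); first by rewrite exprMn -natrX lerDr.
  elim: (2 ^ n)%N => [|k ih]; first by rewrite mul0r addr0 expr0.
  rewrite exprS; apply: le_trans (_ : (1 + u ^+ n) * (1 + k%:R * u ^+ n) <= _); last first.
    by rewrite ler_wpM2l// addr_ge0.
  have : 0 <= k%:R * u ^+ n * u ^+ n by rewrite !mulr_ge0.
  by rewrite -[k.+1]addn1 natrD; lra.
rewrite /steppoly -exprMn exprn_ile1//.
  by rewrite mulr_ge0 ?subr_ge0// addr_ge0.
by have := sqr_ge0 (u ^+ n); rewrite expr2; lra.
Qed.

End trigonometric_multipliers.

(** * Indicators of Borel sets are multipliers *)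

Section trigonometric_density.
Context {R : realType}.
Local Notation mu := (@lebesgue_measure R).
Context (a lam : R) (lam_gt0 : 0 < lam).
Implicit Types (f g h m : R -> R[i]) (c : R[i]).

Local Notation W := (`[a, a + lam]%classic : set R).
Local Notation trigspan := (trigspan a lam).
Local Notation trigmult := (trigmult a lam).

Lemma trigmult_ae m m' (K : R) : trigmult m -> cmeasurable m' ->
  (forall x, csq (m' x) <= K) ->
  {ae mu, forall x, W x -> m x = m' x} -> trigmult m'.
Proof.
move=> tm mm' m'K mE; have [_ [K' mK'] _] := tm.
apply: (@trigmult_lim _ _ _ lam_gt0 (fun=> m) m' (Num.max K K')) => //.
- by move=> _ x; rewrite le_max mK' orbT.
- by move=> x; rewrite le_max m'K.
apply: ae_imp mE => x h Wx; under eq_fun do rewrite (h Wx) subrr csq0.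
exact: cvg_cst.
Qed.

Lemma ae_neq (p : R) : {ae mu, forall x, x <> p}.
Proof.
exists [set p]; split => //; first exact: lebesgue_measure_set1.
by move=> x /= /contrapT.
Qed.

Lemma csq_indic_le1 (E : set R) x : csq ((\1_E x)%:C : R[i]) <= 1.
Proof. by rewrite csq_real indicE; case: (x \in E); rewrite ?expr1n// expr0n. Qed.

(* On [W] this wave has the sign of [c - x]. *)
Definition wave (c x : R) : R := sin (pi * (x - a) / lam) * sin (pi * (c - x) / lam).

(** Each sine alone has frequency [1 / (2 * lam)], which is not admissible; by the product-to-sum
    formula the product is [(cos (y - th) - cos de) / 2] with [y = 2 * pi * x / lam], which involves
    only the indices -1, 0 and 1. *)
Lemma trigmult_wave (c : R) : trigmult (fun x => (wave c x)%:C).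
Proof.
pose th := pi * (a + c) / lam; pose de := pi * (c - a) / lam.
have E x : (wave c x)%:C =
   ((1 / 4)%:C * cexpi (- th)) * chr (1%:~R / lam) x +
   (((1 / 4)%:C * cexpi th) * chr ((-1)%:~R / lam) x + (- (cos de) / 2)%:C).
  rewrite /wave /chr; set y := 2 * pi * x / lam.
  have l0 : lam != 0 by rewrite gt_eqF.
  have -> : 2 * pi * x * (1%:~R / lam) = y by rewrite /y mul1r.
  have -> : 2 * pi * x * ((-1)%:~R / lam) = - y by rewrite /y mulN1r mulrN.
  have -> : pi * (x - a) / lam = (y - th + de) / 2 by rewrite /y /th /de; field.
  have -> : pi * (c - x) / lam = (de - (y - th)) / 2 by rewrite /y /th /de; field.
  have ss (A B : R) : sin ((A + B) / 2) * sin ((B - A) / 2) = (cos A - cos B) / 2.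
    have -> : cos A = cos ((A + B) / 2 - (B - A) / 2) by congr cos; field.
    have -> : cos B = cos ((A + B) / 2 + (B - A) / 2) by congr cos; field.
    by rewrite cosB cosD; field.
  rewrite ss.
  apply: eq_cpart; rewrite !cpartE /cexpi !cosN !sinN /= ?cosB ?sinB.
    by field.
  by field.
rewrite (funext E); apply: trigmultD; first exact: lam_gt0.
  by apply: trigmultM; [exact: trigmult_cst|exact: trigmult_chr].
apply: trigmultD; [exact: lam_gt0| |exact: trigmult_cst].
by apply: trigmultM; [exact: trigmult_cst|exact: trigmult_chr].
Qed.

Lemma trigmult_ray (c : R) : trigmult (fun x => (\1_(`]-oo, c[%classic : set R) x)%:C).
Proof.
have mI : cmeasurable (fun x => (\1_(`]-oo, c[%classic : set R) x)%:C : R[i]).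
  by apply: cmeasurable_real; apply: measurable_indic; exact: measurable_itv.
have [ca|ac] := leP c a.
  apply: (trigmult_ae (trigmult_cst a lam_gt0 0) mI (csq_indic_le1 _)).
  apply: aeW => x; rewrite /= in_itv /= => /andP[ax _].
  by rewrite indicE memNset//= in_itv /=; apply/negP; rewrite -leNgt (le_trans ca).
have [cal|acl] := leP (a + lam) c.
  apply: (trigmult_ae (trigmult_cst a lam_gt0 1) mI (csq_indic_le1 _)).
  apply: ae_imp (ae_neq (a + lam)) => x /= xal; rewrite in_itv /= => /andP[_ xal'].
  rewrite indicE mem_set//= in_itv /=; apply: lt_le_trans cal.
  by rewrite lt_neqAle xal' andbT; exact/eqP.
(* Rescaled to [0, 1] so that the change of sign of the wave at [c] becomes the crossing of the
   threshold 1/2 of [steppoly]. *)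
pose u x := (1 - wave c x) / 2.
have w1 x : -1 <= wave c x <= 1.
  rewrite -ler_norml /wave normrM.
  by rewrite mulr_ile1// ler_norml sin_geN1 sin_le1.
have u01 x : 0 <= u x <= 1 by rewrite /u; have := w1 x; lra.
have mult_u : trigmult (fun x => (u x)%:C).
  rewrite (_ : (fun x => _) = (fun x => (1 / 2)%:C + (- (1 / 2))%:C * (wave c x)%:C)).
    apply: trigmultD; [exact: lam_gt0|exact: trigmult_cst|].
    by apply: trigmultM; [exact: trigmult_cst|exact: trigmult_wave].
  by apply/funext => x; rewrite -rmorphM -rmorphD; congr (_%:C); rewrite /u; field.
apply: (@trigmult_lim _ _ _ lam_gt0 (fun n x => (steppoly (u x) n)%:C) _ 1) => //.
- move=> n; rewrite (_ : (fun x => _) = (fun x => (1 + (-1) * (u x)%:C ^+ n) ^+ (2 ^ n))).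
    apply: trigmultX; first exact: lam_gt0.
    apply: trigmultD; [exact: lam_gt0|exact: trigmult_cst|].
    apply: trigmultM; first exact: trigmult_cst.
    by apply: trigmultX; [exact: lam_gt0|exact: mult_u].
  by apply/funext => x; rewrite /steppoly rmorphXn rmorphB rmorph1 rmorphXn mulN1r.
- move=> n x; rewrite csq_real; have := steppoly_itv n (u01 x).
  by move=> /andP[s0 s1]; rewrite exprn_ile1.
- by move=> x; exact: csq_indic_le1.
(* At these three points the wave vanishes and [u] is exactly 1/2, where neither convergence lemma
   applies; they form a null set. *)
apply: ae_imp (ae_and (ae_neq a) (ae_and (ae_neq (a + lam)) (ae_neq c))) => x /=.
move=> [/eqP xa [/eqP xal /eqP xc]]; rewrite in_itv /= => /andP[ax' xal'].
have {ax' xa} ax : a < x by rewrite lt_neqAle eq_sym xa.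
have {xal' xal} xal : x < a + lam by rewrite lt_neqAle xal.
have s1 : 0 < sin (pi * (x - a) / lam).
  apply: sin_gt0_pi; rewrite divr_gt0 ?mulr_gt0 ?pi_gt0 ?subr_gt0//=.
  by rewrite ltr_pdivrMr// ltr_pM2l ?pi_gt0//; lra.
suff s : steppoly (u x) @ \oo --> (\1_(`]-oo, c[%classic : set R) x : R).
  under eq_fun do rewrite -rmorphB csq_real expr2.
  rewrite -(mulr0 0); apply: cvgM; rewrite -(subrr (\1_(`]-oo, c[%classic) x : R));
    by apply: cvgB => //; exact: cvg_cst.
have [xltc|cltx|/eqP] := ltgtP x c; last by rewrite (negbTE xc).
- rewrite indicE mem_set /= ?in_itv//; apply: steppoly_cvg1.
  have s2 : 0 < sin (pi * (c - x) / lam).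
    apply: sin_gt0_pi; rewrite divr_gt0 ?mulr_gt0 ?pi_gt0 ?subr_gt0//=.
    by rewrite ltr_pdivrMr// ltr_pM2l ?pi_gt0//; lra.
  have w0 : 0 < wave c x by rewrite mulr_gt0.
  by have /andP[-> _] := u01 x; rewrite /u; lra.
- rewrite indicE memNset /= ?in_itv/=; last by apply/negP; rewrite -leNgt ltW.
  apply: steppoly_cvg0.
  have s2 : 0 < sin (pi * (x - c) / lam).
    apply: sin_gt0_pi; rewrite divr_gt0 ?mulr_gt0 ?pi_gt0 ?subr_gt0//=.
    by rewrite ltr_pdivrMr// ltr_pM2l ?pi_gt0//; lra.
  have w0 : wave c x < 0.
    rewrite /wave -(opprB x c) mulrN mulNr sinN mulrN oppr_lt0.
    by rewrite mulr_gt0.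
  by have /andP[_ ->] := u01 x; rewrite /u andbT; lra.
Qed.

Lemma cmeasurable_indic (E : set R) : measurable E ->
  cmeasurable (fun x => (\1_E x)%:C : R[i]).
Proof. by move=> mE; apply: cmeasurable_real; exact: measurable_indic. Qed.

Lemma trigmult_indic (E : set R) : measurable E ->
  trigmult (fun x => (\1_E x)%:C).
Proof.
move=> mE; suff: [set A : set R | measurable A /\ trigmult (fun x => (\1_A x)%:C)] E.
  by case.
have mER : (@RGenInftyO.G R).-sigma.-measurable E by rewrite -RGenInftyO.measurableE.
apply: (smallest_sub _ _ mER); last first.
  by move=> _ [x ->]; split; [exact: measurable_itv|exact: trigmult_ray].
(* A class stable under proper differences, increasing unions and finite intersections: on
   indicators these are subtraction, pointwise limit and product, all of which preserve
   multipliers. *)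
apply/sigma_algebraP => //; split.
- split; first exact: measurableT.
  rewrite (_ : (fun x => _) = (fun=> 1)); first exact: trigmult_cst.
  by apply/funext => x; rewrite indicE mem_set.
- move=> A B BA [mA tA] [mB tB]; split; first exact: measurableD.
  rewrite (_ : (fun x => _) = (fun x => (\1_A x)%:C + (-1) * (\1_B x)%:C)).
    apply: trigmultD; [exact: lam_gt0|exact: tA|].
    by apply: trigmultM; [exact: trigmult_cst|exact: tB].
  apply/funext => x; rewrite mulN1r -rmorphB; congr (_%:C); rewrite !indicE.
  rewrite in_setD; have [Bx|Bx] := boolP (x \in B).
    have -> : x \in A by rewrite inE; apply: BA; rewrite inE in Bx; exact: Bx.
    by rewrite subrr.
  by rewrite andbT subr0.
- move=> F ndF tF.
  have mF : measurable (\bigcup_n F n).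
    by apply: bigcupT_measurable => n; have [] := tF n.
  split => //.
  apply: (@trigmult_lim _ _ _ lam_gt0 (fun n x => (\1_(F n) x)%:C) _ 1).
  + by move=> n; have [] := tF n.
  + exact: cmeasurable_indic.
  + by move=> n x; exact: csq_indic_le1.
  + by move=> x; exact: csq_indic_le1.
  apply: aeW => x _; have [[n _ Fnx]|Fx] := pselect ((\bigcup_n F n) x).
    apply: cvg_near_cst; exists n => // k /= nk.
    have Fkx : F k x by move/subsetPset: (ndF _ _ nk); exact.
    by rewrite !indicE !mem_set ?subrr ?csq0//; exists n.
  under eq_fun => n.
    rewrite !indicE !memNset ?subrr ?csq0//; last by move=> Fnx; apply: Fx; exists n.
    over.
  exact: cvg_cst.
- move=> A B [mA tA] [mB tB]; split; first exact: measurableI.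
  rewrite (_ : (fun x => _) = (fun x => (\1_A x)%:C * (\1_B x)%:C)).
    exact: trigmultM.
  by apply/funext => x; rewrite -rmorphM indicI.
Qed.

End trigonometric_density.

(** * Parseval's identity for Fourier series *)

Section series_parseval.
Context {R : realType}.
Local Notation mu := (@lebesgue_measure R).
Context (a lam : R) (lam_gt0 : 0 < lam).
Implicit Types (f g h m : R -> R[i]) (c : R[i]) (u : R -> R).

Local Notation W := (`[a, a + lam]%classic : set R).
Local Notation trigspan := (trigspan a lam).
Local Notation trigmult := (trigmult a lam).
Local Notation chrW := (chrW a lam).
Local Notation trigsum := (trigsum a lam).

Lemma trigmult_sum (s : seq R) (F : R -> R -> R[i]) : (forall i, trigmult (F i)) ->
  trigmult (fun x => \sum_(i <- s) F i x).
Proof.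
move=> tF; elim: s => [|i s ih].
  by under eq_fun do rewrite big_nil; exact: trigmult_cst.
by under eq_fun do rewrite big_cons; exact: trigmultD.
Qed.

Import HBNNSimple.

Lemma trigmult_nnsfun (s : {nnsfun R >-> R}) :
  trigmult (fun x => (s x)%:C).
Proof.
rewrite (_ : (fun x => _) = (fun x => \sum_(y <- fset_set (range s))
    (y%:C * (\1_(s @^-1` [set y]) x)%:C))).
  apply: trigmult_sum => y; apply: trigmultM; first exact: trigmult_cst.
  by apply: trigmult_indic => //; exact: (measurable_funPTI s).
apply/funext => x; rewrite fimfunE fsbig_finite//= rmorph_sum.
by apply: eq_bigr => y _; rewrite rmorphM.
Qed.

Lemma trigspan_ge0 u : measurable_fun setT u -> (forall x, 0 <= u x) ->
  inL2 (fun x => (u x)%:C) -> (forall x, ~ W x -> u x = 0) ->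
  trigspan (fun x => (u x)%:C).
Proof.
move=> mu_ u0 u2 uW.
have mu' : measurable_fun [set: R] (EFin \o u) by exact/measurable_EFinP.
pose s := nnsfun_approx measurableT mu'.
have sle n (x : R) : (s n x : R) <= u x.
  rewrite -lee_fin /s nnsfun_approxE.
  by apply: (@le_approx _ _ _ setT (EFin \o u)) => // y _; rewrite lee_fin.
have scvg (x : R) : (fun n => s n x : R) @ \oo --> (u x : R).
  have := @cvg_nnsfun_approx _ _ _ setT measurableT (EFin \o u) mu' (fun y _ => u0 y) x I.
  exact: EFin_cvgn.
(* The simple function [s n] acts as a multiplier on [chrW 0], the indicator of [W], which places
   its restriction to [W] in the closed span. *)
apply: (@trigspan_lim _ _ _ lam_gt0 (fun n x => (s n x)%:C * chrW 0 x)) => //.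
- move=> n; have [_ _ h] := trigmult_nnsfun (s n).
  by apply: h; exact: trigspan_chrW.
- by move=> x Wx; rewrite uW.
have chrW0 x : chrW 0 x = (\1_W x)%:C.
  by rewrite !chrWE /chr mul0r mulr0 cexpi0 mulr1.
have E n x : (s n x)%:C * chrW 0 x - (u x)%:C = (if x \in W then s n x - u x else 0)%:C.
  rewrite chrW0 indicE; case: ifPn => [_|]; first by rewrite mulr1 rmorphB.
  by rewrite notin_setE => /uW ->; rewrite mulr0 subr0.
under eq_fun do under eq_fun do rewrite E.
apply: (@L2_dominated _ _ (fun x => csq ((u x)%:C : R[i]))).
- move=> n; under eq_fun do rewrite -E.
  apply: cmeasurableB; last exact: cmeasurable_real.
  apply: cmeasurableM; first exact/cmeasurable_real/measurable_funP.
  by have [] := @inL2_chrW R a lam lam_gt0 0.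
- exact: integrable_csq.
- move=> n x; rewrite !csq_real; case: ifPn => _; last by rewrite expr0n sqr_ge0.
  have := sle n x; have : 0 <= s n x by [].
  by move=> s0 su; rewrite -sqrrN opprB ler_sqr ?nnegrE ?subr_ge0// lerBlDr lerDl.
apply: aeW => x; under eq_fun do rewrite csq_real.
case: (boolP (x \in W)) => _; last by rewrite expr0n; exact: cvg_cst.
under eq_fun do rewrite expr2.
rewrite -(mulr0 0) -(subrr (u x)).
by apply: cvgM; apply: cvgB => //; exact: cvg_cst.
Qed.

Lemma trigspan_inL2 h : inL2 h -> (forall x, ~ W x -> h x = 0) -> trigspan h.
Proof.
move=> h2 hW; have [[mr mi] _] := h2.
have pos u : measurable_fun setT u -> (forall x, u x ^+ 2 <= csq (h x)) ->
    (forall x, ~ W x -> u x = 0) -> trigspan (fun x => (Num.max (u x) 0)%:C).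
  move=> mu_ uh uW; have mmax : measurable_fun setT (fun x => Num.max (u x) 0).
    exact: measurable_maxr.
  apply: trigspan_ge0 => //.
  - by move=> x; rewrite le_max lexx orbT.
  - apply: (inL2_le _ (integrable_csq h2)); first exact: cmeasurable_real.
    move=> x; rewrite csq_real; apply: le_trans (uh x).
    by rewrite /Num.max; case: ifPn => // _; rewrite expr0n sqr_ge0.
  - by move=> x /uW ->; rewrite maxxx.
pose P1 x := (Num.max (complex.Re (h x)) 0)%:C : R[i].
pose P2 x := (Num.max (- complex.Re (h x)) 0)%:C : R[i].
pose P3 x := (Num.max (complex.Im (h x)) 0)%:C : R[i].
pose P4 x := (Num.max (- complex.Im (h x)) 0)%:C : R[i].
have E x : h x = (P1 x + (-1) * P2 x) + (0 +i* 1) * (P3 x + (-1) * P4 x).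
  have mx (r : R) : Num.max r 0 - Num.max (- r) 0 = r.
    have [r0|] := boolP (0 <= r); last rewrite -ltNge => r0.
      by rewrite (max_idPl r0) (max_idPr _) ?subr0// oppr_le0.
    by rewrite (max_idPr (ltW r0)) (max_idPl _) ?sub0r ?opprK// oppr_ge0 ltW.
  have := mx (complex.Re (h x)); have := mx (complex.Im (h x)).
  rewrite /P1 /P2 /P3 /P4 !mulN1r => hi hr.
  by apply: eq_cpart; rewrite !cpartE /= ?hr ?hi !(mul0r, mul1r, subr0, addr0, oppr0, add0r).
rewrite (funext E).
have hw x : ~ W x -> complex.Re (h x) = 0 /\ complex.Im (h x) = 0 by move=> /hW ->.
apply: trigspanD => //; last (apply: trigspanZ => //);
  (apply: trigspanD => //; last (apply: trigspanZ => //)); apply: pos;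
  try (by []); try exact: measurableT_comp;
  try (by move=> x; rewrite ?sqrrN /csq ?lerDl ?lerDr ?sqr_ge0);
  by move=> x /hw[re0 im0]; rewrite ?re0 ?im0 ?oppr0.
Qed.

Lemma cexpi_2pi (n : int) : cexpi (2 * pi * n%:~R) = 1 :> R[i].
Proof.
have nat_case (k : nat) : cexpi (2 * pi * k%:R) = 1 :> R[i].
  elim: k => [|k ih]; first by rewrite mulr0 cexpi0.
  rewrite -[k.+1]addn1 (natrD _ k 1) mulrDr cexpiD ih mul1r mulr1 /cexpi.
  by rewrite mulrC mulr_natr cos2pi sin2pi.
case: n => k; first exact: nat_case.
rewrite NegzE mulrNz mulrN -cexpiJ nat_case.
by apply: eq_cpart; rewrite !cpartE //= oppr0.
Qed.

(** For [k != 0] the exponential has a primitive of period [lam], whose values at the two ends of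
    [W] agree. *)
Lemma integral_chr (k : int) : k != 0 ->
  cintegral (fun x => (\1_W x)%:C * chr (k%:~R / lam) x) = 0.
Proof.
move=> k0; set t := k%:~R / lam.
have t0 : 2 * pi * t != 0.
  by rewrite !mulf_neq0 ?invr_eq0 ?intr_eq0// gt_eqF// pi_gt0.
have per : chr t (a + lam) = chr t a.
  rewrite /chr (_ : 2 * pi * (a + lam) * t = 2 * pi * a * t + 2 * pi * k%:~R).
    by rewrite cexpiD cexpi_2pi mulr1.
  by rewrite /t; field; rewrite gt_eqF.
have aal : a < a + lam by rewrite ltrDl.
have ftc (f F : R -> R) : (forall x : R, is_derive x (1 : R) F (f x)) -> continuous f ->
    F (a + lam) = F a -> \int[mu]_x (\1_W x * f x) = 0.
  move=> dF cf FF; rewrite /Rintegral.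
  rewrite (@eq_integralT _ _ ((fun x => (f x)%:E) \_ W)); last first.
    by move=> x; rewrite patchE indicE; case: ifPn => _; rewrite ?mul1r ?mul0r.
  rewrite -integral_mkcond (@continuous_FTC2 _ f F)//.
  - by rewrite FF -EFinB subrr.
  - exact: continuous_subspaceT.
  - have cF : continuous F.
      by move=> x; apply: differentiable_continuous; apply/derivable1_diffP; have [] := dF x.
    split.
    + by move=> x _; have [] := dF x.
    + by apply: cvg_at_right_filter; exact: cF.
    + by apply: cvg_at_left_filter; exact: cF.
  - by move=> x _; rewrite derive1E; have [_] := dF x.
have cosE x : chr t x = cos (2 * pi * t * x) +i* sin (2 * pi * t * x).
  by rewrite /chr (_ : 2 * pi * x * t = 2 * pi * t * x)//; ring.
have cl (r : R) : continuous (fun x : R => r * x).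
  by move=> x; apply: cvgM; [exact: cvg_cst|exact: cvg_id].
rewrite /cintegral [RHS](_ : 0 = 0 +i* 0)//; congr Complex.
- under eq_Rintegral do rewrite ReM !ImC mul0r subr0 ReC cosE /=.
  apply: (@ftc _ (fun x => (2 * pi * t)^-1 * sin (2 * pi * t * x))).
  + move=> x; apply: is_derive_eq.
    by rewrite /GRing.scale /= mulr1 mulrCA mulVf// mulr1.
  + by move=> x; apply: continuous_comp; [exact: cl|exact: continuous_cos].
  + by move: per; rewrite !cosE => -[_ ->].
- under eq_Rintegral do rewrite ImM !ImC mul0r addr0 ReC cosE /=.
  apply: (@ftc _ (fun x => - (2 * pi * t)^-1 * cos (2 * pi * t * x))).
  + move=> x; apply: is_derive_eq.
    by rewrite /GRing.scale /= mulr1 !mulNr mulrN opprK mulrCA mulVf// mulr1.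
  + by move=> x; apply: continuous_comp; [exact: cl|exact: continuous_sin].
  + by move: per; rewrite !cosE => -[-> _].
Qed.

Lemma chrW_orthogonal (m n : int) :
  L2inner (chrW m) (chrW n) = if m == n then lam%:C else 0.
Proof.
have E x : chrW m x * (chrW n x)^* = (\1_W x)%:C * chr ((m - n)%:~R / lam) x.
  have i2 : (\1_W x)%:C * (\1_W x)%:C = (\1_W x)%:C :> R[i].
    by rewrite -rmorphM indicE; case: (x \in W); rewrite ?mulr1 ?mulr0.
  rewrite !chrWE intrB mulrBl chrD.
  rewrite (_ : chr (- (n%:~R / lam)) x = (chr (n%:~R / lam) x)^*); last first.
    by rewrite /chr cexpiJ mulrN.
  rewrite -[in RHS]i2.
  by apply: eq_cpart; rewrite !cpartE !ReC !ImC; ring.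
case: eqVneq => [->|mn].
  rewrite L2inner_self; last exact: inL2_chrW.
  congr (_%:C); rewrite /nsq L2normsqE (@eq_integralT _ _ (fun x => (\1_W x)%:E)).
    by rewrite integral_indic ?setIT//; exact: (congr1 fine (mu_W a lam_gt0)).
  move=> x; rewrite !chrWE csqM csq_chr mulr1 csq_real.
  by rewrite indicE; case: (x \in W); rewrite ?expr1n// expr0n.
by rewrite /L2inner (funext E) integral_chr// subr_eq0.
Qed.

End series_parseval.

(** * Bessel's inequality and Parseval's identity on a segment *)

Section parseval_identity.
Context {R : realType}.
Local Notation mu := (@lebesgue_measure R).
Context (a lam : R) (lam_gt0 : 0 < lam).
Implicit Types (h : R -> R[i]).

Local Notation W := (`[a, a + lam]%classic : set R).
Local Notation chrW := (chrW a lam).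
Local Notation trigsum := (trigsum a lam).

Lemma L2inner_trigsum h s k : inL2 h ->
  L2inner h (trigsum s k) = \sum_(n <- s) (k n)^* * L2inner h (chrW n).
Proof.
move=> h2; rewrite L2innerJ//; last exact: inL2_trigsum.
rewrite L2inner_suml//; last by move=> n; apply: inL2Z; exact: inL2_chrW.
elim: s => [|n s ih]; first by rewrite !big_nil; apply: eq_cpart; rewrite !cpartE //= oppr0.
rewrite !big_cons -ih L2innerZl//; last exact: inL2_chrW.
rewrite (L2innerJ h2 (inL2_chrW a lam_gt0 n)).
by apply: eq_cpart; rewrite !cpartE; ring.
Qed.

Lemma Re_sum (I : Type) (s : seq I) (F : I -> R[i]) :
  complex.Re (\sum_(i <- s) F i) = \sum_(i <- s) complex.Re (F i).
Proof.
elim: s => [|i s ih]; first by rewrite !big_nil.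
by rewrite !big_cons ReD ih.
Qed.

Lemma nsq_trigsum s k : uniq s ->
  nsq (trigsum s k) = lam * \sum_(n <- s) csq (k n).
Proof.
move=> us; have t2 := inL2_trigsum a lam_gt0 s k.
have : complex.Re (L2inner (trigsum s k) (trigsum s k)) = nsq (trigsum s k).
  by rewrite L2inner_self.
rewrite L2inner_trigsum// => <-; rewrite Re_sum mulr_sumr.
rewrite big_seq [RHS]big_seq; apply: eq_bigr => n ns.
rewrite L2inner_suml; last exact: inL2_chrW.
  rewrite (bigD1_seq n)//= big1 => [|m mn]; last first.
    by rewrite L2innerZl ?(chrW_orthogonal a lam_gt0) ?(negbTE mn) ?mulr0//; exact: inL2_chrW.
  rewrite addr0 L2innerZl ?(chrW_orthogonal a lam_gt0) ?eqxx; try exact: inL2_chrW.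
  by rewrite !cpartE ReC ImC /csq; ring.
by move=> m; apply: inL2Z; exact: inL2_chrW.
Qed.

(** Completing the square in each coefficient: the last term measures the distance to the optimal
    coefficients. It vanishes for the best approximation and may be dropped in a lower bound, which
    are the two halves of Parseval's identity. *)
Lemma nsq_sub_trigsum h s k : inL2 h -> uniq s ->
  nsq (fun x => h x - trigsum s k x) = nsq h
    - lam^-1 * (\sum_(n <- s) csq (L2inner h (chrW n)))
    + lam * (\sum_(n <- s) csq (k n - (lam^-1)%:C * L2inner h (chrW n))).
Proof.
move=> h2 us; rewrite nsqB//; last exact: inL2_trigsum.
rewrite nsq_trigsum// L2inner_trigsum// Re_sum -!addrA; congr (_ + _).
rewrite !mulr_sumr -!sumrN -!big_split /=; apply: eq_bigr => n _.
move: (L2inner h (chrW n)) (k n) => c d.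
by rewrite /csq !cpartE ReC ImC; field; rewrite gt_eqF.
Qed.

(** The factor [lam] is the squared norm of [chrW n], these functions being orthogonal but not
    normalised; it is the source of the division by [lambda] in the fiber bounds. *)
Lemma parseval h : inL2 h -> (forall x, ~ W x -> h x = 0) ->
  (\esum_(n in [set: int]) (csq (L2inner h (chrW n)))%:E = (lam * nsq h)%:E)%E.
Proof.
move=> h2 hW; apply/eqP; rewrite eq_le; apply/andP; split.
  apply: ge_ereal_sup => _ [A [finA _] <-].
  rewrite fsbig_finite//= sumEFin lee_fin.
  (* Bessel's inequality, from the optimal coefficients. *)
  have := nsq_ge0 (fun x => h x - trigsum (fset_set A)
    (fun n => (lam^-1)%:C * L2inner h (chrW n)) x).
  rewrite nsq_sub_trigsum//; last exact: finmap.fset_uniq.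
  rewrite [X in _ + lam * X]big1 => [|n _]; last by rewrite subrr csq0.
  by rewrite mulr0 addr0 subr_ge0 mulrC ler_pdivrMr// mulrC.
apply/lee_addgt0Pr => e e0.
(* Completeness: an approximation with error below [e / lam], whatever its coefficients, already
   forces [lam * nsq h] below [e] plus the sum over its frequencies. *)
have [_ _ /(_ _ (divr_gt0 e0 lam_gt0))[[s k] /= us he]] := trigspan_inL2 lam_gt0 h2 hW.
have sS : (\sum_(n <- s) (csq (L2inner h (chrW n)))%:E <=
    \esum_(n in [set: int]) (csq (L2inner h (chrW n)))%:E)%E.
  apply: esum_ge; exists [set` s]; first by split => //; exact: finite_seq.
  by rewrite fsbig_seq.
apply: le_trans (leeD2r _ sS); rewrite sumEFin -EFinD lee_fin.
move: he; rewrite nsq_sub_trigsum// => he.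
have q0 : 0 <= lam * (\sum_(n <- s) csq (k n - (lam^-1)%:C * L2inner h (chrW n))).
  by apply: mulr_ge0; [exact: ltW|apply: sumr_ge0 => n _; exact: csq_ge0].
have {he q0} he : nsq h < (e + \sum_(n <- s) csq (L2inner h (chrW n))) / lam.
  by rewrite mulrDl [X in _ + X]mulrC; lra.
by rewrite addrC mulrC -ler_pdivlMr// ltW.
Qed.

End parseval_identity.

(** * Translation invariance of the integral *)

Section translation.
Context {R : realType}.
Local Notation mu := (@lebesgue_measure R).
Implicit Types (f g : R -> R[i]).

Lemma lebesgue_measure_translate (t : R) (A : set R) : measurable A ->
  pushforward mu ((fun x => x - t) : measurableTypeR R -> measurableTypeR R) A = mu A.
Proof.
move=> mA; apply/esym/lebesgue_measure_unique => //=.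
  by apply: measurable_funB.
move=> mt _ [[b c]] _ <-.
rewrite /pushforward (_ : _ @^-1` _ = `]b + t, c + t]%classic); last first.
  by apply/seteqP; split => x /=; rewrite !in_itv /= ltrBrDr lerBlDr.
rewrite !lebesgue_measure_itv/= !lte_fin ltrD2r.
by case: ifPn => // _; rewrite -!EFinD; congr EFin; ring.
Qed.

Lemma ge0_integral_translate (t : R) (u : R -> \bar R) :
  measurable_fun [set: R] u -> (forall x, (0 <= u x)%E) ->
  (\int[mu]_x u (x - t)%R = \int[mu]_x u x)%E.
Proof.
move=> mu_ u0.
have mt : measurable_fun setT ((fun x => x - t) : measurableTypeR R -> measurableTypeR R).
  by apply: measurable_funB.
rewrite -(@ge0_integral_pushforward _ _ _ _ R _ mt mu setT u)//.
by apply: eq_measure_integral => //= A mA _; exact: lebesgue_measure_translate.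
Qed.

Lemma measurable_translate (t : R) (u : R -> R) :
  measurable_fun [set: R] u -> measurable_fun [set: R] (fun x => u (x - t)).
Proof.
move=> mu_; have mt : measurable_fun [set: R] (fun x : R => x - t) by exact: measurable_funB.
exact: (measurableT_comp mu_ mt).
Qed.

Lemma cmeasurable_translate t f : cmeasurable f -> cmeasurable (translate t f).
Proof.
move=> [f1 f2].
by split; [exact: (measurable_translate t f1)|exact: (measurable_translate t f2)].
Qed.

Lemma L2normsq_translate t f : cmeasurable f ->
  L2normsq (translate t f) = L2normsq f.
Proof.
move=> mf; rewrite !L2normsqE.
apply: (@ge0_integral_translate t (fun x => (csq (f x))%:E)).
  by apply/measurable_EFinP; exact: measurable_csq.
by move=> x; rewrite lee_fin csq_ge0.
Qed.

Lemma inL2_translate t f : inL2 f -> inL2 (translate t f).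
Proof.
move=> [mf f2]; split; first exact: cmeasurable_translate.
by rewrite L2normsq_translate.
Qed.

Lemma Rintegral_translate (t : R) (u : R -> R) :
  measurable_fun [set: R] u ->
  \int[mu]_x u (x - t) = \int[mu]_x u x.
Proof.
move=> mu_; have mE : measurable_fun [set: R] (EFin \o u) by exact/measurable_EFinP.
have mt : measurable_fun [set: R] (fun x => (u (x - t))%:E).
  by apply/measurable_EFinP; exact: measurable_translate.
have E1 : (\int[mu]_x (fun x => (u (x - t)%R)%:E)^\+ x = \int[mu]_x (EFin \o u)^\+ x)%E.
  rewrite -(@ge0_integral_translate t (EFin \o u)^\+%E)//; last exact: measurable_funepos.
  by apply: eq_integralT => x; rewrite unlock.
have E2 : (\int[mu]_x (fun x => (u (x - t)%R)%:E)^\- x = \int[mu]_x (EFin \o u)^\- x)%E.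
  rewrite -(@ge0_integral_translate t (EFin \o u)^\-%E)//; last exact: measurable_funeneg.
  by apply: eq_integralT => x; rewrite unlock.
have E : (\int[mu]_x (u (x - t)%R)%:E = \int[mu]_x (EFin \o u) x)%E.
  by rewrite [LHS]integralE [RHS]integralE E1 E2.
exact: (congr1 fine E).
Qed.

Lemma cintegral_translate (t : R) f : cmeasurable f ->
  cintegral (translate t f) = cintegral f.
Proof.
move=> [f1 f2]; rewrite /cintegral; congr Complex.
- exact: (Rintegral_translate t f1).
- exact: (Rintegral_translate t f2).
Qed.

End translation.

(** * The Fourier transform on compactly supported functions *)

Section countable_sums.
Context {R : realType}.
Local Notation mu := (@lebesgue_measure R).

(** Integers outside the range of [pickle] contribute 0. Written as a series, an unordered sum
    becomes accessible to termwise integration and to measurability of limits. *)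
Lemma esum_pickle (T : countType) (f : T -> \bar R) : (forall i, (0 <= f i)%E) ->
  (\esum_(i in [set: T]) f i = \sum_(k <oo) oapp f 0 (pickle_inv k))%E.
Proof.
move=> f0; pose f' (k : nat) := oapp f 0%E (pickle_inv k : option T).
have f'0 k : (0 <= f' k)%E by rewrite /f'; case: pickle_inv => //= i; exact: f0.
rewrite nneseries_esumT//.
transitivity (\esum_(k in range (@pickle T)) f' k)%E.
  rewrite (esum_image setT (@pickle T) f').
    by apply: eq_esum => i _; rewrite /f' pickleK_inv.
  by move=> i j _ _; exact: (pcan_inj (@pickleK T)).
rewrite esum_mkcond; apply: eq_esum => k _; case: ifPn => //.
rewrite notin_setE /f' => kT; case E: (pickle_inv k) => [i|]//=.
by exfalso; apply: kT; exists i => //; have := @pickle_invK T k; rewrite E /=.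
Qed.

Lemma integral_esum (T : countType) (g : T -> R -> \bar R) :
  (forall i, measurable_fun [set: R] (g i)) -> (forall i x, (0 <= g i x)%E) ->
  (\int[mu]_x (\esum_(i in [set: T]) g i x) =
   \esum_(i in [set: T]) (\int[mu]_x g i x))%E.
Proof.
move=> mg g0; rewrite esum_pickle; last by move=> i; exact: integral_ge0.
transitivity (\int[mu]_x (\sum_(k <oo) oapp (g^~ x) 0 (pickle_inv k)))%E.
  by apply: eq_integralT => x; rewrite esum_pickle.
rewrite integral_nneseries//.
- apply: eq_eseriesr => k _; case: pickle_inv => [i|]//=.
  by rewrite integral0.
- by move=> k; case: pickle_inv => [i|]//=; exact: mg.
- by move=> k x _; case: pickle_inv => [i|]//=.
Qed.

Lemma measurable_esum (T : countType) (g : T -> R -> \bar R) :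
  (forall i, measurable_fun [set: R] (g i)) -> (forall i x, (0 <= g i x)%E) ->
  measurable_fun [set: R] (fun x => (\esum_(i in [set: T]) g i x)%E).
Proof.
move=> mg g0.
rewrite (_ : (fun x => _) = fun x => (\sum_(k <oo) oapp (g^~ x) 0 (pickle_inv k))%E).
  apply: ge0_emeasurable_sum => [k x _ _|k _]; first by case: pickle_inv => [i|]//=.
  by case: (pickle_inv k) => [i|] /=; [exact: mg|exact: measurable_cst].
by apply/funext => x; rewrite esum_pickle.
Qed.

Lemma esumZl (T : countType) (f : T -> \bar R) (c : R) :
  0 <= c -> (forall i, (0 <= f i)%E) ->
  (\esum_(i in [set: T]) (c%:E * f i) = c%:E * \esum_(i in [set: T]) f i)%E.
Proof.
move=> c0 f0; rewrite !esum_pickle//; last by move=> i; rewrite mule_ge0// lee_fin.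
rewrite -nneseriesZl; last by move=> k _; case: pickle_inv => [i|]//=.
by apply: eq_eseriesr => k _; case: pickle_inv => [i|]//=; rewrite mule0.
Qed.

End countable_sums.

(** * Measurability of integrals depending on a parameter *)

Section fourier_measurable.
Context {R : realType}.
Local Notation mu := (@lebesgue_measure R).
Local Notation RR := (measurableTypeR R * measurableTypeR R)%type.

(** Tonelli's theorem applies to the positive and negative parts; composing with [fine] keeps
    measurability, also at the points where the integral diverges and takes a default value. *)
Lemma measurable_Rintegral1 (u : RR -> R) : measurable_fun setT u ->
  measurable_fun [set: R] (fun y => \int[mu]_x u (x, y)).
Proof.
move=> mu_.
have mE : measurable_fun setT (EFin \o u) by exact/measurable_EFinP.
have E y : (\int[mu]_x (u (x, y))%:E =
   \int[mu]_x (EFin \o u)^\+ (x, y) - \int[mu]_x (EFin \o u)^\- (x, y))%E.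
  by rewrite integralE; congr (_ - _)%E; apply: eq_integralT => x; rewrite !unlock.
rewrite /Rintegral; under eq_fun do rewrite E.
apply: measurableT_comp => //.
apply: emeasurable_funB.
- apply: (@measurable_fun_fubini_tonelli_G _ _ _ _ _ mu (EFin \o u)^\+%E) => //.
  exact: measurable_funepos.
- apply: (@measurable_fun_fubini_tonelli_G _ _ _ _ _ mu (EFin \o u)^\-%E) => //.
  exact: measurable_funeneg.
Qed.

Definition cmeasurable2 (F : RR -> R[i]) :=
  measurable_fun setT (fun z => complex.Re (F z)) /\
  measurable_fun setT (fun z => complex.Im (F z)).

Lemma cmeasurable2M F G : cmeasurable2 F -> cmeasurable2 G ->
  cmeasurable2 (fun z => F z * G z).
Proof.
move=> [f1 f2] [g1 g2]; split.
- by under eq_fun do rewrite ReM; apply: measurable_funB; exact: measurable_funM.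
- by under eq_fun do rewrite ImM; apply: measurable_funD; exact: measurable_funM.
Qed.

Lemma cmeasurable2_fst (f : R -> R[i]) : cmeasurable f -> cmeasurable2 (fun z => f z.1).
Proof.
by move=> [f1 f2]; split; [exact: (measurableT_comp f1 measurable_fst)|
  exact: (measurableT_comp f2 measurable_fst)].
Qed.

Lemma cmeasurable2_snd (f : R -> R[i]) : cmeasurable f -> cmeasurable2 (fun z => f z.2).
Proof.
by move=> [f1 f2]; split; [exact: (measurableT_comp f1 measurable_snd)|
  exact: (measurableT_comp f2 measurable_snd)].
Qed.

Lemma cmeasurable2_kernel : cmeasurable2 (fun z => cexpi (- (2 * pi * z.1 * z.2))).
Proof.
have mp : measurable_fun setT (fun z : RR => - (2 * pi * z.1 * z.2) : R).
  apply: measurableT_comp => //; apply: measurable_funM; last exact: measurable_snd.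
  by apply: measurable_funM => //; exact: measurable_fst.
split => /=.
- by apply: measurableT_comp mp; exact: continuous_measurable_fun (@continuous_cos R).
- by apply: measurableT_comp mp; exact: continuous_measurable_fun (@continuous_sin R).
Qed.

Lemma cmeasurable_cintegral (F : RR -> R[i]) : cmeasurable2 F ->
  cmeasurable (fun y => cintegral (fun x => F (x, y))).
Proof.
move=> [F1 F2]; split.
- exact: (measurable_Rintegral1 F1).
- exact: (measurable_Rintegral1 F2).
Qed.

Lemma cmeasurable_fourier (f : R -> R[i]) : cmeasurable f -> cmeasurable (fourier f).
Proof.
move=> mf.
apply: (@cmeasurable_cintegral (fun z => f z.1 * cexpi (- (2 * pi * z.1 * z.2)))).
by apply: cmeasurable2M cmeasurable2_kernel; exact: cmeasurable2_fst.
Qed.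

End fourier_measurable.

(** * Plancherel's theorem from samples of the transform *)

Section plancherel_bounded_support.
Context {R : realType}.
Local Notation mu := (@lebesgue_measure R).
Implicit Types (f g : R -> R[i]).

Lemma esum_single (T : choiceType) (f : T -> \bar R) (i0 : T) :
  (0 <= f i0)%E -> (forall i, i != i0 -> f i = 0%E) ->
  (\esum_(i in [set: T]) f i = f i0)%E.
Proof.
move=> f0 fi; rewrite -[RHS]esum_set1// [RHS]esum_mkcond; apply: eq_esum => i _.
case: ifPn => //; rewrite notin_setE => /= /eqP; exact: fi.
Qed.

(** The translates of [[0, 1 / L[] by multiples of [1 / L] tile the line; since the cells are
    half-open, [x] lies in exactly one, the cell of index [floor (x * L)]. *)
Lemma integral_periodize (L : R) (G : R -> \bar R) : 0 < L ->
  measurable_fun [set: R] G -> (forall x, (0 <= G x)%E) ->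
  (\int[mu]_x G x = \int[mu]_(s in `[0%R, (L^-1)%R[)
     (\esum_(n in [set: int]) G (s + n%:~R / L)%R))%E.
Proof.
move=> L0 mG G0; pose I0 := (`[0, L^-1[%classic : set R).
have mI0 : measurable I0 by exact: measurable_itv.
pose g' (n : int) s := ((\1_I0 s)%:E * G (s + n%:~R / L)%R)%E.
have mshift n : measurable_fun [set: R] (fun s => G (s + n%:~R / L)%R).
  have mt : measurable_fun [set: R] (fun x : R => x + n%:~R / L) by exact: measurable_funD.
  exact: (measurableT_comp mG mt).
have mg' n : measurable_fun [set: R] (g' n).
  apply: emeasurable_funM => //; apply/measurable_EFinP; exact: measurable_indic.
have g'0 n s : (0 <= g' n s)%E by rewrite mule_ge0// lee_fin.
transitivity (\int[mu]_x (\esum_(n in [set: int]) g' n (x - n%:~R / L)%R))%E.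
  apply: eq_integralT => x; rewrite (@esum_single _ _ (Num.floor (x * L))).
  - rewrite /g' subrK indicE mem_set ?mul1e// /I0 /= in_itv /=.
    rewrite subr_ge0 ler_pdivrMr// floor_le//= ltrBlDr -[X in X + _]div1r -mulrDl.
    by rewrite ltr_pdivlMr// addrC; have := floorD1_gt (x * L); rewrite intrD.
  - by [].
  - move=> n nx; rewrite /g' indicE memNset ?mul0e// /I0 /= in_itv /= => /andP[].
    rewrite subr_ge0 ler_pdivrMr// => nx1.
    rewrite ltrBlDr -[X in X + _]div1r -mulrDl ltr_pdivlMr// addrC => nx2.
    move/negP: nx; apply; apply/eqP/esym/floor_def; rewrite nx1/=.
    by rewrite intrD.
rewrite integral_esum//; last first.
  move=> n; have mt : measurable_fun [set: R] (fun x : R => x - n%:~R / L).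
    exact: measurable_funB.
  exact: (measurableT_comp (mg' n) mt).
under eq_esum => n _ do rewrite (ge0_integral_translate (n%:~R / L) (mg' n) (g'0 n)).
rewrite -integral_esum// [RHS]integral_mkcond; apply: eq_integralT => s.
rewrite patchE; case: ifPn => sI.
  by apply: eq_esum => n _; rewrite /g' indicE sI mul1e.
by rewrite esum1// => n _; rewrite /g' indicE (negbTE sI) mul0e.
Qed.

(* Up to the factor [exp (- 2 pi i x s)] put on [f], the samples at [s + n / L]
   are the Fourier coefficients on a segment of length [L]. *)
Lemma fourier_samples f (a L s : R) : 0 < L -> inL2 f ->
  (forall x, ~ (`[a, a + L]%classic : set R) x -> f x = 0) ->
  (\esum_(n in [set: int]) (csq (fourier f (s + n%:~R / L)))%:E = (L * nsq f)%:E)%E.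
Proof.
move=> L0 f2 fW; pose h x := cexpi (- (2 * pi * x * s)) * f x.
have mc : cmeasurable (fun x => cexpi (- (2 * pi * x * s)) : R[i]).
  apply: measurable_cexpi; apply: measurableT_comp => //.
  by apply: measurable_funM => //; exact: measurable_funM.
have h2 : inL2 h by apply: (@inL2M_bounded _ _ 1) => // x; rewrite csq_cexpi.
have hW x : ~ (`[a, a + L]%classic : set R) x -> h x = 0 by move=> /fW xW; rewrite /h xW mulr0.
rewrite -(@eq_nsq _ h) => [|x]; last by rewrite /h csqM csq_cexpi mul1r.
rewrite -(parseval L0 h2 hW); apply: eq_esum => n _; congr (csq _)%:E.
rewrite /fourier /L2inner; congr cintegral; apply/funext => x.
rewrite chrWE indicE; case: (boolP (x \in `[a, a + L]%classic)) => xW.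
  rewrite /h /chr (_ : - (2 * pi * x * (s + n%:~R / L)) =
     - (2 * pi * x * s) + - (2 * pi * x * (n%:~R / L))); last by ring.
  by rewrite cexpiD -[cexpi (- (_ * (n%:~R / L)))]cexpiJ mul1r; ring.
by rewrite notin_setE in xW; rewrite hW// fW// !mul0r.
Qed.

(* Average the previous identity over [s] in [[0, 1 / L[]. *)
Lemma plancherel_bounded f (a L : R) : 0 < L -> inL2 f ->
  (forall x, ~ (`[a, a + L]%classic : set R) x -> f x = 0) ->
  inL2 (fourier f) /\ nsq (fourier f) = nsq f.
Proof.
move=> L0 f2 fW; have mF := cmeasurable_fourier f2.1.
have E : L2normsq (fourier f) = (nsq f)%:E.
  rewrite L2normsqE (integral_periodize L0); first last.
  - by move=> x; rewrite lee_fin csq_ge0.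
  - by apply/measurable_EFinP; exact: measurable_csq.
  under eq_integral => s _ do rewrite (fourier_samples s L0 f2 fW).
  rewrite integral_cst//= lebesgue_measure_itv/= lte_fin invr_gt0 L0.
  by rewrite -EFinD -EFinM subr0 mulrAC mulfV ?mul1r// gt_eqF.
by split; [split => //; rewrite E ltry|rewrite /nsq E].
Qed.

End plancherel_bounded_support.

(** * Transforms of square integrable functions with bounded support *)

Section compact_support.
Context {R : realType}.
Local Notation mu := (@lebesgue_measure R).
Implicit Types (f g h : R -> R[i]) (c : R[i]).

(** On this class the integral defining [fourier] converges at every frequency, so linearity and the
    rule for translations hold pointwise, as equalities of functions. *)
Definition L2c f := inL2 f /\ exists M : R, forall x, M < `|x| -> f x = 0.

Lemma L2cD f g : L2c f -> L2c g -> L2c (fun x => f x + g x).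
Proof.
move=> [f2 [M fM]] [g2 [K gK]]; split; first exact: inL2D.
by exists (Num.max M K) => x; rewrite gt_max => /andP[/fM -> /gK ->]; rewrite addr0.
Qed.

Lemma L2cZ c f : L2c f -> L2c (fun x => c * f x).
Proof.
move=> [f2 [M fM]]; split; first exact: inL2Z.
by exists M => x /fM ->; rewrite mulr0.
Qed.

Lemma L2cB f g : L2c f -> L2c g -> L2c (fun x => f x - g x).
Proof.
move=> fc gc; under eq_fun do rewrite -mulN1r.
by apply: L2cD => //; exact: L2cZ.
Qed.

Lemma L2c_translate t f : L2c f -> L2c (translate t f).
Proof.
move=> [f2 [M fM]]; split; first exact: inL2_translate.
exists (M + `|t|) => x Mx; apply: fM; move: Mx; rewrite -ltrBrDr => Mx.
by apply: (lt_le_trans Mx); exact: lerB_dist.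
Qed.

Lemma L2c_itv f : L2c f -> exists a L : R,
  0 < L /\ forall x, ~ (`[a, a + L]%classic : set R) x -> f x = 0.
Proof.
move=> [_ [M fM]]; exists (- `|M|), (2 * `|M| + 1); split.
  by rewrite ltr_wpDl// mulr_ge0.
move=> x xM; apply: fM; rewrite ltNge; apply/negP => xM'; apply: xM.
rewrite /= in_itv /=; have := le_trans xM' (ler_norm M).
by rewrite ler_norml => /andP[-> h] /=; apply: (le_trans h); lra.
Qed.

Lemma L2c_cintegrable f (gamma : R) : L2c f ->
  cintegrable (fun x => f x * cexpi (- (2 * pi * x * gamma))).
Proof.
move=> fc; have [a [L [L0 fW]]] := L2c_itv fc; have [f2 _] := fc.
(* The exponential cut off to the segment is square integrable, which presents the integrand as a
   product of two L^2 functions. *)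
have e2 : inL2 (fun x => chr gamma x * (\1_(`[a, a + L]%classic : set R) x)%:C).
  apply: (@inL2M_bounded _ _ 1); first exact: cmeasurable_chr.
    by move=> x; rewrite csq_chr.
  apply: inL2_indic; first exact: measurable_W.
  by rewrite (mu_W a L0) ltry.
have := cintegrable_mulJ f2 e2.
rewrite (_ : (fun x => _) = (fun x => f x * cexpi (- (2 * pi * x * gamma))))//.
apply/funext => x; case: (pselect ((`[a, a + L]%classic : set R) x)) => xW.
  have -> : (\1_(`[a, a + L]%classic : set R) x)%:C = 1 :> R[i] by rewrite indicE mem_set.
  by rewrite mulr1; congr (_ * _); exact: cexpiJ.
by rewrite fW// !mul0r.
Qed.

Lemma fourierD f g gamma : L2c f -> L2c g ->
  fourier (fun x => f x + g x) gamma = fourier f gamma + fourier g gamma.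
Proof.
move=> fc gc; rewrite /fourier -cintegralD; try exact: L2c_cintegrable.
by congr cintegral; apply/funext => x; rewrite mulrDl.
Qed.

Lemma fourierZ c f gamma : L2c f ->
  fourier (fun x => c * f x) gamma = c * fourier f gamma.
Proof.
move=> fc; rewrite /fourier -cintegralZ; last exact: L2c_cintegrable.
by congr cintegral; apply/funext => x; rewrite mulrA.
Qed.

Lemma fourierB f g gamma : L2c f -> L2c g ->
  fourier (fun x => f x - g x) gamma = fourier f gamma - fourier g gamma.
Proof.
move=> fc gc; under [in LHS]eq_fun do rewrite -mulN1r.
by rewrite fourierD ?fourierZ ?mulN1r//; exact: L2cZ.
Qed.

Lemma fourier_translate t f gamma : L2c f ->
  fourier (translate t f) gamma = cexpi (- (2 * pi * t * gamma)) * fourier f gamma.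
Proof.
move=> fc; rewrite /fourier -cintegralZ; last exact: L2c_cintegrable.
pose k x := cexpi (- (2 * pi * t * gamma)) * (f x * cexpi (- (2 * pi * x * gamma))).
have mk : cmeasurable k.
  apply: cmeasurableM; first exact: cmeasurable_cst.
  apply: cmeasurableM; first exact: fc.1.1.
  apply: measurable_cexpi; apply: measurableT_comp => //.
  by apply: measurable_funM => //; exact: measurable_funM.
rewrite -/k -(cintegral_translate t mk); congr cintegral; apply/funext => x.
rewrite /translate /k mulrCA -cexpiD; congr (_ * cexpi _); ring.
Qed.

Lemma plancherelc f : L2c f -> inL2 (fourier f) /\ nsq (fourier f) = nsq f.
Proof.
move=> fc; have [a [L [L0 fW]]] := L2c_itv fc.
exact: plancherel_bounded L0 fc.1 fW.
Qed.

(** Polarization: the real part comes from the norm of the sum, the imaginary part from the real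
    part for ['i * g]. *)
Lemma parsevalc f g : L2c f -> L2c g ->
  L2inner (fourier f) (fourier g) = L2inner f g.
Proof.
move=> fc gc.
have ReE h : L2c h -> complex.Re (L2inner (fourier f) (fourier h)) = complex.Re (L2inner f h).
  move=> hc; have [_] := plancherelc (L2cD fc hc).
  rewrite (eq_nsq (g := fun x => fourier f x + fourier h x)); last first.
    by move=> x; rewrite fourierD.
  have [F2 FE] := plancherelc fc; have [H2 HE] := plancherelc hc.
  have [f2 _] := fc; have [h2 _] := hc.
  by rewrite !nsqD// FE HE => /addrI /(mulfI _); apply; rewrite pnatr_eq0.
apply: eq_cpart; first exact: ReE.
have := ReE _ (L2cZ 'i gc).
rewrite (_ : fourier (fun x => 'i * g x) = (fun x => 'i * fourier g x)); last first.
  by apply/funext => x; rewrite fourierZ.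
rewrite !L2innerZr//; try exact: (plancherelc _).1; try exact: fc.1; try exact: gc.1.
move: (L2inner _ _) (L2inner _ _) => z w.
by rewrite !cpartE /= !mul0r !sub0r !mulNr !mul1r !opprK.
Qed.

Lemma truncateE N f x : truncate N f x = (\1_(`[- N%:R, N%:R]%classic : set R) x)%:C * f x.
Proof.
rewrite /truncate indicE; case: ifPn => xN.
  by rewrite mem_set ?mul1r//= in_itv /= -ler_norml.
by rewrite memNset ?mul0r//= in_itv /= -ler_norml; exact/negP.
Qed.

Lemma L2c_truncate N f : inL2 f -> L2c (truncate N f).
Proof.
move=> f2; split.
  rewrite (funext (truncateE N f)); apply: (@inL2M_bounded _ _ 1) => //.
    by apply: cmeasurable_indic; exact: measurable_itv.
  by move=> x; exact: csq_indic_le1.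
by exists N%:R => x; rewrite ltNge /truncate => /negbTE ->.
Qed.

Lemma truncate_cvg f : inL2 f ->
  (fun N => nsq (fun x => truncate N f x - f x)) @ \oo --> (0 : R).
Proof.
move=> f2; apply: (@L2_dominated _ _ (fun x => csq (f x))).
- by move=> N; apply: cmeasurableB f2.1; exact: (L2c_truncate N f2).1.1.
- exact: integrable_csq.
- move=> N x; rewrite /truncate; case: ifPn => _.
    by rewrite subrr csq0 csq_ge0.
  by rewrite sub0r csqN.
apply: aeW => x; apply: cvg_near_cst.
exists (Num.truncn `|x|).+1 => // N /= xN; rewrite /truncate ifT ?subrr ?csq0//.
by apply: ltW; apply: lt_le_trans (truncnS_gt _) _; rewrite ler_nat.
Qed.

End compact_support.

(** * The Fourier transform on $L^2(R)$ *)

Section riesz_fischer.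
Context {R : realType}.
Local Notation mu := (@lebesgue_measure R).
Implicit Types (f g : R -> R[i]).

(* [u k - 2 C / 2^k] increases, [u k + 2 C / 2^k] decreases. *)
Lemma geometric_limit (u : nat -> R) (C : R) :
  (forall k, `|u k.+1 - u k| <= C / 2 ^+ k) ->
  exists l, forall k, `|u k - l| <= 2 * C / 2 ^+ k.
Proof.
move=> uC; pose v k := u k - 2 * C / 2 ^+ k; pose w k := u k + 2 * C / 2 ^+ k.
have half k : 2 * C / 2 ^+ k.+1 = C / 2 ^+ k.
  by rewrite exprS invfM; field; rewrite expf_neq0 // pnatr_eq0.
have dbl k : 2 * C / 2 ^+ k = C / 2 ^+ k + C / 2 ^+ k by rewrite -mulrA mulr_natl mulr2n.
have vS k : v k <= v k.+1.
  have := uC k; rewrite ler_norml => /andP[h1 h2].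
  by rewrite /v half dbl; lra.
have wS k : w k.+1 <= w k.
  have := uC k; rewrite ler_norml => /andP[h1 h2].
  by rewrite /w half dbl; lra.
have vmono : {homo v : m n / (m <= n)%N >-> m <= n} by apply: homo_leq => //; exact: le_trans.
have wmono : {homo w : m n / (m <= n)%N >-> n <= m}.
  by apply: (@homo_leq _ w (fun x y => y <= x)) => //= y x z xy yz; exact: le_trans yz xy.
have C0 : 0 <= C by have := uC 0%N; rewrite expr0 divr1; apply: le_trans.
have vw k : v k <= w k.
  by rewrite /v /w lerBlDr -addrA lerDl addr_ge0// divr_ge0 ?exprn_ge0// mulr_ge0.
have vlew m n : v m <= w n.
  apply: (le_trans (vmono _ _ (leq_maxl m n))); apply: (le_trans (vw _)).
  exact: wmono (leq_maxr m n).
have ubv : has_ubound (range v) by exists (w 0%N) => _ [m _ <-]; exact: vlew.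
exists (sup (range v)) => k.
have h1 : v k <= sup (range v) by apply: ub_le_sup => //; exists k.
have h2 : sup (range v) <= w k.
  by apply: ge_sup; [exists (v 0%N); exists 0%N|move=> _ [m _ <-]; exact: vlew].
by move: h1 h2; rewrite /v /w ler_norml => h1 h2; lra.
Qed.

Lemma cvg_geometric_bound (u : nat -> R) (l B : R) :
  (forall k, `|u k - l| <= B / 2 ^+ k) -> u @ \oo --> l.
Proof.
move=> uB; apply/subr_cvg0; apply/norm_cvg0P.
apply: (@cvg_squeeze0 _ _ (fun k => B * (1 / 2) ^+ k)).
  by move=> k; rewrite normr_ge0/= div1r exprVn; exact: uB.
by apply: cvg_geometric; rewrite ger0_norm; lra.
Qed.

(** The rate [8 ^- k] leaves room for the weights [4 ^+ k]: the weighted squared increments have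
    integrals at most [2 ^- k], and the weights turn a finite sum into geometric decay of the
    increments at each point. *)
Lemma nsq_fast_cauchy (G : nat -> R -> R[i]) : (forall k, inL2 (G k)) ->
  (forall k, nsq (fun x => G k.+1 x - G k x) <= (8^-1) ^+ k) ->
  exists2 g, inL2 g & (fun k => nsq (fun x => G k x - g x)) @ \oo --> (0 : R).
Proof.
move=> G2 Gd; pose d k x := G k.+1 x - G k x.
have d2 k : inL2 (d k) by exact: inL2B.
(* [D] is integrable, hence finite almost everywhere, and there it bounds
   the increments by [2 ^- k * sqrt (D x)]. *)
pose D x : \bar R := (\sum_(k <oo) (4 ^+ k * csq (d k x))%:E)%E.
have mt k : measurable_fun [set: R] (fun x => (4 ^+ k * csq (d k x))%:E).
  by apply/measurable_EFinP; apply: measurable_funM => //; apply: measurable_csq; have [] := d2 k.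
have t0 k x : (0 <= (4 ^+ k * csq (d k x))%:E)%E by rewrite lee_fin mulr_ge0 ?exprn_ge0 ?csq_ge0.
have D0 x : (0 <= D x)%E by exact: nneseries_ge0.
have mD : measurable_fun [set: R] D by apply: ge0_emeasurable_sum => // k x _ _; exact: t0.
have iD : (\int[mu]_x D x < +oo)%E.
  rewrite /D integral_nneseries//.
  (* The bound is [2 ^- k], written in the shape of the terms of [cvg_geometric_eseries_half]. *)
  have le2 k : (\int[mu]_x (4 ^+ k * csq (d k x))%:E <= (2 / (2 ^ (k + 1))%:R)%:E)%E.
    under eq_integral do rewrite EFinM.
    rewrite ge0_integralZl_EFin//.
    - rewrite -L2normsqE L2normsq_nsq// -EFinM lee_fin.
      apply: (@le_trans _ _ (4 ^+ k * 8^-1 ^+ k)).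
        by rewrite ler_wpM2l ?exprn_ge0//; exact: Gd.
      rewrite addn1 natrX exprS invfM mulrA mulfV// mul1r -exprMn -exprVn.
      by rewrite (_ : 4 * 8^-1 = 2^-1 :> R)//; field.
    - by move=> x _; rewrite lee_fin csq_ge0.
    - by apply/measurable_EFinP; apply: measurable_csq; have [] := d2 k.
  apply: (@le_lt_trans _ _ (\sum_(k <oo) (2 / (2 ^ (k + 1))%:R)%:E)%E).
    by apply: lee_nneseries => [k _ _|k _]; [exact: integral_ge0|exact: le2].
  have /cvg_lim -> // := @cvg_geometric_eseries_half R 2 0.
  by rewrite ltry.
have tD k x : ((4 ^+ k * csq (d k x))%:E <= D x)%E.
  apply: le_trans (nneseries_lim_ge k.+1 _) => //.
  by rewrite big_nat_recr//= leeDr// sume_ge0.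
have iD' : mu.-integrable setT D.
  by apply/integrableP; split => //; under eq_integral do rewrite gee0_abs//.
pose A := [set x | D x \is a fin_num].
have mA : measurable A by rewrite -[A]setTI; exact: emeasurable_fin_num.
have aeA : {ae mu, forall x, A x} by apply: ae_imp (integrable_ae measurableT iD') => x; exact.
(* Outside [A] the sequence is replaced by 0, so that the increment bound, and with it the limit,
   exists at every point and not only almost everywhere. *)
pose G' k x := (\1_A x)%:C * G k x.
pose C x := Num.sqrt (fine (D x)).
have step k x : csq (G' k.+1 x - G' k x) <= fine (D x) / 4 ^+ k.
  rewrite -mulrBr csqM csq_real indicE; case: (boolP (x \in A)) => xA; last first.
    by rewrite expr0n mul0r divr_ge0 ?exprn_ge0// fine_ge0.
  rewrite expr1n mul1r ler_pdivlMr ?exprn_gt0// mulrC -lee_fin.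
  by rewrite inE in xA; rewrite fineK//; exact: tD.
have pow4 k : 4 ^+ k = (2 ^+ k) ^+ 2 :> R.
  by rewrite -exprM mulnC exprM; congr (_ ^+ k); rewrite -natrX.
have C4 k x : Num.sqrt (fine (D x) / 4 ^+ k) = C x / 2 ^+ k.
  rewrite sqrtrM ?fine_ge0// pow4 -[((2 ^+ k) ^+ 2)^-1]exprVn sqrtr_sqr.
  by rewrite ger0_norm// invr_ge0 exprn_ge0.
have sqrt_le (r q : R) : r ^+ 2 <= q -> `|r| <= Num.sqrt q.
  by move=> rq; rewrite -sqrtr_sqr ler_wsqrtr.
have stepR x k : `|complex.Re (G' k.+1 x) - complex.Re (G' k x)| <= C x / 2 ^+ k.
  rewrite -ReN -ReD -C4; apply: sqrt_le; apply: le_trans (step k x).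
  by rewrite /csq lerDl sqr_ge0.
have stepI x k : `|complex.Im (G' k.+1 x) - complex.Im (G' k x)| <= C x / 2 ^+ k.
  rewrite -ImN -ImD -C4; apply: sqrt_le; apply: le_trans (step k x).
  by rewrite /csq lerDr sqr_ge0.
have [gr hr] := choice (fun x => geometric_limit (stepR x)).
have [gi hi] := choice (fun x => geometric_limit (stepI x)).
have mG' k : cmeasurable (G' k).
  by apply: cmeasurableM; [exact: cmeasurable_indic|have [] := G2 k].
pose g x := gr x +i* gi x.
have mg : cmeasurable g.
  split => /=.
  - apply: (@measurable_fun_cvg _ _ _ _ (fun k x => complex.Re (G' k x))).
      by move=> k; have [] := mG' k.
    by move=> x _; exact: cvg_geometric_bound (hr x).
  - apply: (@measurable_fun_cvg _ _ _ _ (fun k x => complex.Im (G' k x))).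
      by move=> k; have [] := mG' k.
    by move=> x _; exact: cvg_geometric_bound (hi x).
have dist k x : csq (G' k x - g x) <= 8 / 4 ^+ k * fine (D x).
  (* Real and imaginary parts are each within [2 * C x / 2 ^+ k] of their limits, and [C x] squared
     is [fine (D x)]. *)
  have -> : 8 / 4 ^+ k * fine (D x) = (2 * C x / 2 ^+ k) ^+ 2 + (2 * C x / 2 ^+ k) ^+ 2.
    rewrite -[in LHS](sqr_sqrtr (fine_ge0 (D0 x))) -/(C x) pow4; field.
    by rewrite expf_neq0// pnatr_eq0.
  have sqle (r q : R) : `|r| <= q -> r ^+ 2 <= q ^+ 2.
    move=> rq; rewrite -(real_normK (num_real r)) ler_sqr ?nnegrE//.
    exact: le_trans rq.
  by rewrite /csq ReD ReN ImD ImN; apply: lerD; apply: sqle; [exact: hr|exact: hi].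
have distE k : (L2normsq (fun x => G k x - g x)%R <= (8 / 4 ^+ k)%:E * \int[mu]_x D x)%E.
  rewrite L2normsqE -ge0_integralZl_EFin//.
  apply: ae_ge0_le_integral => //.
  - by move=> x _; rewrite lee_fin csq_ge0.
  - by apply/measurable_EFinP; apply: measurable_csq; apply: cmeasurableB mg; have [] := G2 k.
  - by move=> x _; rewrite mule_ge0// lee_fin divr_ge0 ?exprn_ge0.
  - exact: measurable_funeM.
  apply: ae_imp aeA => x Ax _; rewrite -[D x]fineK// -EFinM lee_fin.
  by have := dist k x; rewrite /G' indicE mem_set// mul1r.
have iDfin : (\int[mu]_x D x)%E \is a fin_num by rewrite ge0_fin_numE// integral_ge0.
have Gg2 k : inL2 (fun x => G k x - g x).
  split; first by apply: cmeasurableB mg; have [] := G2 k.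
  by apply: le_lt_trans (distE k) _; rewrite -[X in (_ * X)%E]fineK// -EFinM ltry.
exists g.
  rewrite (_ : g = fun x => G 0%N x - (G 0%N x - g x)); first exact: inL2B.
  by apply/funext => x; rewrite opprB addrC subrK.
apply: (@cvg_squeeze0 _ _ (fun k => (8 * fine (\int[mu]_x D x)%E) * (1 / 4) ^+ k)) => [k|].
  rewrite nsq_ge0 /= -lee_fin -L2normsq_nsq//; apply: (le_trans (distE k)).
  rewrite -[X in (_ * X <= _)%E]fineK// -EFinM lee_fin div1r exprVn.
  by rewrite mulrAC.
by apply: cvg_geometric; rewrite ger0_norm; lra.
Qed.

End riesz_fischer.

(** * Completeness of L^2 and existence of the transform *)

Section fourier_transform_L2.
Context {R : realType}.
Local Notation mu := (@lebesgue_measure R).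
Implicit Types (f g phi psi : R -> R[i]).

Lemma L2_complete (F : nat -> R -> R[i]) : (forall n, inL2 (F n)) ->
  (forall e : R, 0 < e -> exists N, forall n m, (N <= n)%N -> (N <= m)%N ->
     nsq (fun x => F n x - F m x) < e) ->
  exists2 g, inL2 g & (fun n => nsq (fun x => F n x - g x)) @ \oo --> (0 : R).
Proof.
move=> F2 Fc.
have e0 k : 0 < (8^-1 : R) ^+ k by rewrite exprn_gt0// invr_gt0.
have [N hN] := choice (fun k => Fc _ (e0 k)).
(* The index exceeds [N k], for the rate; its predecessor, so that [phi k.+1] also exceeds [N k];
   and [k], so that the subsequence goes to infinity. *)
pose phi := fix phi k := if k is j.+1 then maxn (maxn (phi j) (N k)) k else N 0%N.
have phiN k : (N k <= phi k)%N.
  by case: k => //= k; exact: leq_trans (leq_maxr _ _) (leq_maxl _ _).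
have phiS k : (phi k <= phi k.+1)%N.
  exact: leq_trans (leq_maxl _ _) (leq_maxl _ _).
have phik k : (k <= phi k)%N by case: k => //= k; exact: leq_maxr.
have [|g g2 gc] := @nsq_fast_cauchy R (fun k => F (phi k)) (fun k => F2 _).
  by move=> k; apply: ltW; apply: hN => //; apply: leq_trans (phiN k) (phiS k).
exists g => //; apply/cvgrPdist_lt => e e_gt0.
have e4 : 0 < e / 4 by lra.
have [M hM] := Fc _ e4.
have /cvgrPdist_lt/(_ _ e4)[K _ hK] := gc.
exists M => // n /= Mn; rewrite sub0r normrN ger0_norm ?nsq_ge0//.
(* This term is late enough both for the Cauchy condition and for the convergence of the
   subsequence. *)
have h1 := hM n (phi (maxn M K)) Mn (leq_trans (leq_maxl M K) (phik _)).
have := hK (maxn M K) (leq_maxr M K).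
rewrite sub0r normrN ger0_norm ?nsq_ge0// => h2.
apply: le_lt_trans (nsq_triangle (F2 n) (F2 (phi (maxn M K))) g2) _.
by lra.
Qed.

Lemma is_fourierL2P f g : inL2 f -> is_fourierL2 f g <->
  inL2 g /\ (fun N => nsq (fun x => fourier (truncate N f) x - g x)) @ \oo --> (0 : R).
Proof.
move=> f2.
have F2 N : inL2 (fourier (truncate N f)) by have [] := plancherelc (L2c_truncate N f2).
by split => -[g2 h]; split => //; apply/L2normsq_cvg0 => // N; exact: inL2B.
Qed.

Lemma fourierL2_exists f : inL2 f -> exists g, is_fourierL2 f g.
Proof.
move=> f2; have tc N := L2c_truncate N f2.
have [|e e0|g g2 gc] := @L2_complete (fun N => fourier (truncate N f)).
- by move=> N; have [] := plancherelc (tc N).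
- have e4 : 0 < e / 4 by lra.
  have /cvgrPdist_lt/(_ _ e4)[K _ hK] := truncate_cvg f2.
  exists K => n m Kn Km.
  rewrite (eq_nsq (g := fourier (fun x => truncate n f x - truncate m f x))); last first.
    by move=> x; rewrite fourierB.
  have [_ ->] := plancherelc (L2cB (tc n) (tc m)).
  have := hK n Kn; have := hK m Km; rewrite !sub0r !normrN !ger0_norm ?nsq_ge0// => h1 h2.
  apply: le_lt_trans (nsq_triangle (tc n).1 f2 (tc m).1) _.
  by rewrite [X in _ + 2 * X]nsqBC; lra.
by exists g; apply/is_fourierL2P.
Qed.

Lemma fourierL2P f : inL2 f -> is_fourierL2 f (fourierL2 f).
Proof. by move=> /fourierL2_exists[g fg]; exact: (@xgetI _ _ _ g). Qed.

Definition modulate (t : R) psi (gamma : R) : R[i] := cexpi (- (2 * pi * t * gamma)) * psi gamma.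

Lemma inL2_modulate t psi : inL2 psi -> inL2 (modulate t psi).
Proof.
apply: (@inL2M_bounded _ _ 1); last by move=> x; rewrite csq_cexpi.
by apply: measurable_cexpi; apply: measurableT_comp => //; exact: measurable_funM.
Qed.

(** Both sides are limits of one sequence of inner products. The window is truncated before it is
    translated, so that its transform is exactly a modulation of the transform of the truncation. *)
Lemma L2inner_translate_fourier f phi g psi (t : R) : inL2 f -> inL2 phi ->
  is_fourierL2 f g -> is_fourierL2 phi psi ->
  L2inner f (translate t phi) = L2inner g (modulate t psi).
Proof.
move=> f2 p2 /(is_fourierL2P _ f2)[g2 fg] /(is_fourierL2P _ p2)[s2 ps].
have fc N := L2c_truncate N f2; have pc N := L2c_truncate N p2.
apply: (@csq_cvg_unique _ (fun N => L2inner (truncate N f) (translate t (truncate N phi)))).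
  apply: L2inner_cvg => //.
  - by move=> N; have [] := fc N.
  - by move=> N; apply: inL2_translate; have [] := pc N.
  - exact: inL2_translate.
  - exact: truncate_cvg.
  - rewrite (_ : (fun n => _) = (fun N => nsq (fun x => truncate N phi x - phi x))).
      exact: truncate_cvg.
    apply/funext => N; rewrite /nsq.
    have mt : cmeasurable (fun x => truncate N phi x - phi x).
      by apply: cmeasurableB; [have [[]] := pc N|have [] := p2].
    by rewrite -(L2normsq_translate t mt).
have F2 N : inL2 (fourier (truncate N f)) by have [] := plancherelc (fc N).
have P2 N : inL2 (fourier (truncate N phi)) by have [] := plancherelc (pc N).
under eq_fun => N.
  rewrite -(parsevalc (fc N) (L2c_translate t (pc N))).
  rewrite (_ : fourier (translate t (truncate N phi)) = modulate t (fourier (truncate N phi))).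
    over.
  by apply/funext => x; rewrite fourier_translate.
apply: L2inner_cvg => //.
- by move=> N; exact: inL2_modulate.
- exact: inL2_modulate.
rewrite (_ : (fun n => _) = (fun N => nsq (fun x => fourier (truncate N phi) x - psi x)))//.
apply/funext => N; apply: eq_nsq => x.
by rewrite /modulate -mulrBr csqM csq_cexpi mul1r.
Qed.

Lemma modulate0 psi : modulate 0 psi = psi.
Proof. by apply/funext => x; rewrite /modulate mulr0 mul0r oppr0 cexpi0 mul1r. Qed.

Lemma nsq_fourierL2 f g : inL2 f -> is_fourierL2 f g -> nsq f = nsq g.
Proof.
move=> f2 fg; have [g2 _] := fg.
have := L2inner_translate_fourier 0 f2 f2 fg fg.
rewrite modulate0 (_ : translate 0 f = f); last by apply/funext => x; rewrite /translate subr0.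
by rewrite !L2inner_self// => -[].
Qed.

End fourier_transform_L2.

(** * The multiplication formula and preimages under the transform *)

Section fourier_fubini.
Context {R : realType}.
Local Notation mu := (@lebesgue_measure R).
Local Notation RR := (measurableTypeR R * measurableTypeR R)%type.

(** The product majorant makes every slice integrable, so that the inner real integrals are the true
    ones and not the default value of [fine]. *)
Lemma Rfubini (w : RR -> R) (p q : R -> R) : measurable_fun setT w ->
  mu.-integrable setT (EFin \o p) -> mu.-integrable setT (EFin \o q) ->
  (forall x, 0 <= p x) -> (forall y, 0 <= q y) ->
  (forall x y, `|w (x, y)| <= p x * q y) ->
  \int[mu]_y (\int[mu]_x w (x, y)) = \int[mu]_x (\int[mu]_y w (x, y)).
Proof.
move=> mw ip iq p0 q0 wpq.
have mE : measurable_fun setT (EFin \o w) by exact/measurable_EFinP.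
have slice1 y : mu.-integrable setT (EFin \o (fun x => w (x, y))).
  apply: (le_integrable measurableT _ _ (integrable_RealZ (q y) ip)) => //.
    exact: (measurableT_comp mE (pair2_measurable y)).
  move=> x _ /=; rewrite lee_fin mulrC [leRHS]ger0_norm ?mulr_ge0//; exact: wpq.
have slice2 x : mu.-integrable setT (EFin \o (fun y => w (x, y))).
  apply: (le_integrable measurableT _ _ (integrable_RealZ (p x) iq)) => //.
    exact: (measurableT_comp mE (pair1_measurable x)).
  by move=> y _ /=; rewrite lee_fin [leRHS]ger0_norm ?mulr_ge0//; exact: wpq.
have ge0_integrable_lty (u : R -> R) : mu.-integrable setT (EFin \o u) ->
    (forall x, 0 <= u x) -> (\int[mu]_x (u x)%:E < +oo)%E.
  move=> /integrableP[_ iu] u0; apply: le_lt_trans iu.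
  by rewrite le_eqVlt; apply/orP; left; apply/eqP; apply: eq_integralT => x /=; rewrite ger0_norm.
have iw : (mu \x mu)%E.-integrable setT (EFin \o w).
  apply/integrable12ltyP => //.
  pose Q := fine (\int[mu]_y (q y)%:E)%E.
  have QE : (\int[mu]_y (q y)%:E = Q%:E)%E.
    by rewrite fineK// ge0_fin_numE ?ge0_integrable_lty// integral_ge0// => y _; rewrite lee_fin.
  have Q0 : 0 <= Q by rewrite fine_ge0// integral_ge0// => y _; rewrite lee_fin.
  apply: (@le_lt_trans _ _ (\int[mu]_x (Q * p x)%:E)%E); last first.
    apply: ge0_integrable_lty; first exact: integrable_RealZ.
    by move=> x; rewrite mulr_ge0.
  apply: ge0_le_integral => //.
  - by move=> x _; exact: integral_ge0.
  - apply: (measurable_fun_fubini_tonelli_F (abse \o (EFin \o w))).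
      exact: measurableT_comp.
    by move=> z; exact: abse_ge0.
  - exact: (measurable_int _ (integrable_RealZ Q ip)).
  move=> x _; rewrite mulrC EFinM -QE -ge0_integralZl_EFin//.
  - apply: ge0_le_integral => //.
    + by apply: measurableT_comp => //; exact: (measurable_int _ (slice2 x)).
    + exact: (measurable_int _ (integrable_RealZ (p x) iq)).
    + by move=> y _; rewrite /= -EFinM lee_fin; exact: wpq.
  - by move=> y _; rewrite lee_fin.
  - exact: (measurable_int _ iq).
have E := Fubini iw.
have E1 : (\int[mu]_y (\int[mu]_x w (x, y))%:E = \int[mu]_y \int[mu]_x (EFin \o w) (x, y))%E.
  by apply: eq_integralT => y; rewrite fineK//; exact: integrable_fin_num (slice1 y).
have E2 : (\int[mu]_x (\int[mu]_y w (x, y))%:E = \int[mu]_x \int[mu]_y (EFin \o w) (x, y))%E.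
  by apply: eq_integralT => y; rewrite fineK//; exact: integrable_fin_num (slice2 y).
by rewrite /Rintegral in E1 E2 *; rewrite E1 E2 E.
Qed.

Lemma cfubini (F : RR -> R[i]) (p q : R -> R) : cmeasurable2 F ->
  mu.-integrable setT (EFin \o p) -> mu.-integrable setT (EFin \o q) ->
  (forall x, 0 <= p x) -> (forall y, 0 <= q y) ->
  (forall x y, csq (F (x, y)) <= (p x * q y) ^+ 2) ->
  cintegral (fun y => cintegral (fun x => F (x, y))) =
  cintegral (fun x => cintegral (fun y => F (x, y))).
Proof.
move=> [F1 F2] ip iq p0 q0 Fpq.
have sqrt_le (r s : R) : 0 <= s -> r ^+ 2 <= s ^+ 2 -> `|r| <= s.
  by move=> s0; rewrite -(real_normK (num_real r)) ler_sqr ?nnegrE.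
apply: (f_equal2 (@Complex R)).
- apply: (@Rfubini (fun z => complex.Re (F z)) p q) => // x y.
  apply: sqrt_le; first by rewrite mulr_ge0.
  by apply: le_trans (Fpq x y); rewrite /csq lerDl sqr_ge0.
- apply: (@Rfubini (fun z => complex.Im (F z)) p q) => // x y.
  apply: sqrt_le; first by rewrite mulr_ge0.
  by apply: le_trans (Fpq x y); rewrite /csq lerDr sqr_ge0.
Qed.

(** The majorant is the squared modulus plus the indicator of a carrying segment: for [t >= 0] one
    has [t <= (t + 1) ^+ 2], so no square root is taken. *)
Lemma L2c_majorant (f : R -> R[i]) : L2c f -> exists p : R -> R,
  [/\ mu.-integrable setT (EFin \o p), (forall x, 0 <= p x) &
      forall x, csq (f x) <= p x ^+ 2].
Proof.
move=> fc; have [a [L [L0 fW]]] := L2c_itv fc; have [f2 _] := fc.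
have i0 x : 0 <= \1_(`[a, a + L]%classic : set R) x :> R by [].
exists (fun x => csq (f x) + \1_(`[a, a + L]%classic : set R) x); split.
- apply: integrable_RealD; first exact: integrable_csq.
  by apply: integrable_indic_itv.
- by move=> x; rewrite addr_ge0 ?csq_ge0.
- move=> x; have c0 := csq_ge0 (f x); case: (pselect ((`[a, a + L]%classic : set R) x)) => xW.
    by rewrite indicE mem_set//=; nra.
  by rewrite fW// csq0 sqr_ge0.
Qed.

(* Fubini, the kernel being symmetric in both variables. *)
Lemma fourier_multiplication (h : R -> R[i]) (u : R -> R) : L2c h ->
  L2c (fun x => (u x)%:C) ->
  L2inner (fourier h) (fun x => (u x)%:C) =
  L2inner h (fun x => (fourier (fun y => (u y)%:C) x)^*).
Proof.
move=> hc uc; have [p [ip p0 hp]] := L2c_majorant hc; have [q [iq q0 uq]] := L2c_majorant uc.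
pose F (z : RR) := (h z.1 * cexpi (- (2 * pi * z.1 * z.2))) * (u z.2)%:C.
have mF : cmeasurable2 F.
  apply: cmeasurable2M; last by apply: (@cmeasurable2_snd _ (fun y => (u y)%:C)); have [[]] := uc.
  by apply: cmeasurable2M (@cmeasurable2_kernel R); apply: cmeasurable2_fst; have [[]] := hc.
have FF : forall x y, csq (F (x, y)) <= (p x * q y) ^+ 2.
  by move=> x y; rewrite /F !csqM csq_cexpi mulr1 exprMn ler_pM ?csq_ge0//; exact: uq.
have conjR (r : R) : (r%:C)^* = r%:C :> R[i] by apply: eq_cpart; rewrite !cpartE //= oppr0.
(* Below a product, [^*] is [Num.conj] instead of [conjc]: the two are
   convertible, but [rewrite] does not identify them. *)
have := cfubini mF ip iq p0 q0 FF.
rewrite /L2inner.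
rewrite (_ : (fun y => cintegral (fun x => F (x, y))) = (fun x => fourier h x * ((u x)%:C)^*)).
  move=> ->; congr cintegral; apply/funext => x.
  have cK (z : R[i]) : (z^*)^* = z by apply: eq_cpart; rewrite !cpartE ?opprK.
  rewrite [RHS](_ : _ = h x * fourier (fun y => (u y)%:C) x); last by congr (_ * _); exact: cK.
  rewrite /fourier -cintegralZ; last exact: L2c_cintegrable.
  congr cintegral; apply/funext => y; rewrite /F /=.
  by rewrite (_ : 2 * pi * y * x = 2 * pi * x * y); ring.
apply/funext => y.
rewrite [RHS](_ : _ = fourier h y * (u y)%:C); last by congr (_ * _); exact: conjR.
rewrite mulrC /fourier -cintegralZ; last exact: L2c_cintegrable.
by congr cintegral; apply/funext => x; rewrite mulrC.
Qed.

Lemma inL2J (f : R -> R[i]) : inL2 f ->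
  inL2 (fun x => (f x)^*) /\ nsq (fun x => (f x)^*) = nsq f.
Proof.
move=> f2; split; last by apply: eq_nsq => x; rewrite csqJ.
apply: (inL2_le _ (integrable_csq f2)); first exact: cmeasurableJ f2.1.
by move=> x; rewrite csqJ.
Qed.

(** As [u] is real, the conjugate of its transform is its inverse transform, here called [f].
    Expanding the square of the transform of [truncate N f] minus [u], Plancherel handles the
    squared terms and the multiplication formula the cross term; the result is the squared distance
    from [truncate N f] to [f]. *)
Lemma fourierL2_surj_real (u : R -> R) : L2c (fun x => (u x)%:C) ->
  exists2 f, inL2 f & is_fourierL2 f (fun x => (u x)%:C).
Proof.
move=> uc; have [Fu2 Fun] := plancherelc uc.
have [f2 fn] := inL2J Fu2.
exists (fun x => (fourier (fun y => (u y)%:C) x)^*) => //.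
set f := (fun x => _) in f2 fn *.
apply/is_fourierL2P => //; split; first exact: uc.1.
have tc N := L2c_truncate N f2.
rewrite (_ : (fun N => _) = (fun N => nsq (fun x => truncate N f x - f x))).
  exact: truncate_cvg.
apply/funext => N; have [Ft2 Ftn] := plancherelc (tc N).
rewrite nsqB//; last exact: uc.1.
rewrite nsqB//; last by have [] := tc N.
by rewrite Ftn fn Fun fourier_multiplication.
Qed.

End fourier_fubini.

(** * Supports of Fourier transforms *)

Section essential_support.
Context {R : realType}.
Local Notation mu := (@lebesgue_measure R).
Implicit Types (f g : R -> R[i]).

Lemma ae_forall_count (T : countType) (P : T -> R -> Prop) :
  (forall i, {ae mu, forall x, P i x}) -> {ae mu, forall x, forall i, P i x}.
Proof.
move=> Pi; pose Q (k : nat) x := if pickle_inv k is Some i then P i x else True.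
have : {ae mu, forall x, forall k, Q k x}.
  apply: ae_foralln => k; rewrite /Q; case: pickle_inv => [i|]; first exact: Pi.
  exact: aeW.
by apply: ae_imp => x Qx i; have := Qx (pickle i); rewrite /Q pickleK_inv.
Qed.

(* Lindeloef: balls with rational centre and radius form a countable base. *)
Lemma ess_support_ae0 f (S : set R) : ess_support f `<=` S ->
  {ae mu, forall x, ~ S x -> f x = 0}.
Proof.
move=> fS; pose B (p : rat * rat) : set R := ball (ratr p.1 : R) (ratr p.2).
pose null p := {ae mu, forall x, B p x -> f x = 0}.
have nullP p : {ae mu, forall x, null p -> B p x -> f x = 0}.
  have [np|nnp] := pselect (null p); first by apply: ae_imp np => x h _.
  by apply: aeW => x /nnp.
apply: ae_imp (ae_forall_count nullP) => x h Sx.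
have : (\bigcup_(U in [set U : set R | open U /\ {ae mu, forall x, U x -> f x = 0}]) U) x.
  by apply: contrapT => nx; apply: Sx; apply: fS.
move=> [U [oU Uf] /mem_set Ux].
have [c [r /= [/set_mem xB BU]]] := open_subball_rat oU Ux.
by apply: (h (c, r)) => //; apply: ae_imp Uf => y Uy By; apply: Uy; exact: BU.
Qed.

Lemma itv_sub_segment (I : interval R) (lam : R) : 0 < lam ->
  mu [set` I] = lam%:E -> exists a, [set` I] `<=` (`[a, a + lam]%classic : set R).
Proof.
move=> lam0; have l0 : (0 : \bar R)%E = lam%:E -> False.
  by move=> [] lam00; move: lam0; rewrite -lam00 ltxx.
(* An interval with an infinite end is empty or of infinite measure, both excluded by the positive
   finite measure [lam]. *)
rewrite lebesgue_measure_itv; case: I => [[b x|b] [b' y|b']] /=; last 3 first.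
- by case: b' => /=; rewrite ?ltry //=; move=> /l0.
- by case: b => /=; rewrite ?ltNyr //=; move=> /l0.
- by case: b; case: b' => /=; rewrite ?ltxx ?ltNyy //=; move=> /l0.
case: ifPn => [_|_ /l0 //].
rewrite -EFinB => -[<-]; exists x => z /=; rewrite (addrC x) subrK !in_itv /=.
by case: b; case: b' => /= /andP[xz zy]; apply/andP; split; rewrite ?xz ?zy ?ltW.
Qed.

End essential_support.

(** * Frame sums *)

Section frame_sums.
Context {R : realType}.
Local Notation mu := (@lebesgue_measure R).
Implicit Types (f g phi psi : R -> R[i]).

Lemma esum_translates f g phi psi (a lam : R) : 0 < lam -> inL2 f -> inL2 phi ->
  is_fourierL2 f g -> is_fourierL2 phi psi -> inL2 (fun x => g x * (psi x)^*) ->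
  {ae mu, forall x, ~ (`[a, a + lam]%classic : set R) x -> psi x = 0} ->
  (\esum_(n in [set: int]) (csq (L2inner f (translate (n%:~R / lam) phi)))%:E =
   \int[mu]_x (lam * (csq (g x) * csq (psi x)))%:E)%E.
Proof.
move=> lam0 f2 p2 fg ps gp2 psi0; have [g2 _] := fg; have [s2 _] := ps.
pose W := (`[a, a + lam]%classic : set R); have mW : measurable W := measurable_W a lam.
(* [psi] vanishes off [W] only almost everywhere, while [parseval] asks for every point; the
   indicator selects a suitable representative. *)
pose h x := (\1_W x)%:C * (g x * (psi x)^*).
have h2 : inL2 h.
  by apply: (@inL2M_bounded _ _ 1) => // [|x]; [exact: cmeasurable_indic|exact: csq_indic_le1].
have hW x : ~ W x -> h x = 0 by move=> xW; rewrite /h indicE memNset// mul0r.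
(* The sign changes because translation by [n / lam] already modulates by the conjugate of
   [chr (n / lam)]; the sum over all integers is insensitive to it. *)
have E n : L2inner f (translate (n%:~R / lam) phi) = L2inner h (chrW a lam (- n)).
  rewrite (L2inner_translate_fourier _ f2 p2 fg ps) /L2inner.
  have m2 := inL2_modulate (n%:~R / lam) s2.
  apply: eq_cintegral_ae.
  - by apply: cmeasurableM g2.1 _; apply: cmeasurableJ; have [] := m2.
  - by apply: cmeasurableM h2.1 _; apply: cmeasurableJ; have [] := inL2_chrW a lam0 (- n).
  apply: ae_imp psi0 => x px.
  rewrite chrWE /modulate /h /chr indicE; case: (pselect (W x)) => xW; last first.
    by rewrite px// memNset//; apply: eq_cpart; rewrite !cpartE /=; ring.
  rewrite mem_set// (_ : - (2 * pi * (n%:~R / lam) * x) = 2 * pi * x * ((- n)%:~R / lam)).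
    move: (cexpi _) (psi x) (g x) => z w v.
    by apply: eq_cpart; rewrite !cpartE /=; ring.
  by rewrite mulrNz; ring.
rewrite (reindex_esum setT setT (fun n : int => - n)); last first.
  by split => // [m n _ _ /oppr_inj//|n _]; exists (- n) => //; rewrite opprK.
under eq_esum => n _ do rewrite E opprK.
rewrite (parseval lam0 h2 hW) EFinM -L2normsq_nsq// L2normsqE -ge0_integralZl_EFin//; last first.
- exact: ltW.
- by apply/measurable_EFinP; apply: measurable_csq; have [] := h2.
- by move=> x _; rewrite lee_fin csq_ge0.
have mh : measurable_fun [set: R] (fun x => (lam * (csq (g x) * csq (psi x)))%:E).
  apply/measurable_EFinP; apply: measurable_funM => //.
  by apply: measurable_funM; apply: measurable_csq; [exact: g2.1|exact: s2.1].
apply: ae_eq_integral => //.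
  apply/measurable_EFinP; apply: measurable_funM => //.
  by apply: measurable_csq; have [] := h2.
apply: ae_imp psi0 => x px _; rewrite -EFinM; congr (_ * _)%:E.
rewrite /h !csqM csqJ csq_real indicE; case: (pselect (W x)) => xW.
  by rewrite mem_set// expr1n mul1r.
by rewrite px// csq0 !mulr0.
Qed.

Definition fiber_sum (psi : int -> R -> R[i]) (x : R) : \bar R :=
  (\esum_(l in [set: int]) (csq (psi l x))%:E)%E.

(** The index pairs are swapped so that the inner sum runs over [n] at fixed [l]. Each [psi l] has
    its own segment, but the integral obtained for it is over the whole line, so the sum over [l]
    can then be taken inside. *)
Lemma frame_sum f g (phi psi : int -> R -> R[i]) (lam : R) (q : int -> R) : 0 < lam ->
  (forall l, q l = 1 / lam) ->
  inL2 f -> (forall l, inL2 (phi l)) ->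
  is_fourierL2 f g -> (forall l, is_fourierL2 (phi l) (psi l)) ->
  (forall l, inL2 (fun x => g x * (psi l x)^*)) ->
  (forall l, exists a, {ae mu, forall x, ~ (`[a, a + lam]%classic : set R) x -> psi l x = 0}) ->
  (\esum_(k in [set: int * int])
     ((cmod (L2inner f (translate (k.1%:~R * q k.2) (phi k.2)))) ^+ 2)%:E =
   lam%:E * \int[mu]_x ((csq (g x))%:E * fiber_sum psi x))%E.
Proof.
move=> lam0 qE f2 p2 fg ps gp2 psi0; have [g2 _] := fg.
have mpsi l : measurable_fun [set: R] (fun x => (csq (psi l x))%:E).
  by apply/measurable_EFinP; apply: measurable_csq; have [[]] := ps l.
have mg : measurable_fun [set: R] (fun x => (csq (g x))%:E).
  by apply/measurable_EFinP; apply: measurable_csq; exact: g2.1.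
have mS : measurable_fun [set: R] (fiber_sum psi).
  by apply: measurable_esum => // l x; rewrite lee_fin csq_ge0.
have S0 x : (0 <= fiber_sum psi x)%E by apply: esum_ge0 => l _; rewrite lee_fin csq_ge0.
transitivity (\esum_(l in [set: int]) \esum_(n in [set: int])
   (csq (L2inner f (translate (n%:~R / lam) (phi l))))%:E)%E.
  rewrite esum_esum//; last by move=> i j _ _; rewrite lee_fin csq_ge0.
  rewrite (reindex_esum setT [set: int * int] (fun k : int * int => (k.2, k.1))).
    rewrite (_ : [set: int] `*`` (fun=> [set: int]) = [set: int * int]).
      by apply: eq_esum => -[m n] _; rewrite cmod_sqr /= qE mul1r.
    by apply/seteqP; split.
  by split => // [[m n] [m' n'] _ _ /= [-> ->]//|[m n] _]; exists (n, m).
transitivity (\esum_(l in [set: int]) \int[mu]_x (lam * (csq (g x) * csq (psi l x)))%:E)%E.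
  apply: eq_esum => l _; have [a psil] := psi0 l.
  exact: (esum_translates lam0 f2 (p2 l) fg (ps l) (gp2 l) psil).
rewrite -integral_esum; last 2 first.
- move=> l; apply/measurable_EFinP; apply: measurable_funM => //.
  by apply: measurable_funM; apply: measurable_csq; [exact: g2.1|have [[]] := ps l].
- by move=> l x; rewrite lee_fin !mulr_ge0 ?csq_ge0// ltW.
rewrite -ge0_integralZl_EFin//; last 3 first.
- by move=> x _; rewrite mule_ge0// lee_fin csq_ge0.
- exact: emeasurable_funM.
- exact: ltW.
apply: eq_integralT => x; rewrite muleA -EFinM /fiber_sum -esumZl.
- by apply: eq_esum => l _; rewrite -EFinM mulrA.
- by rewrite mulr_ge0 ?csq_ge0// ltW.
- by move=> l; rewrite lee_fin csq_ge0.
Qed.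

Lemma measurable_fiber_sum (psi : int -> R -> R[i]) : (forall l, cmeasurable (psi l)) ->
  measurable_fun [set: R] (fiber_sum psi).
Proof.
move=> mpsi; apply: measurable_esum => [l|l x]; last by rewrite lee_fin csq_ge0.
by apply/measurable_EFinP; apply: measurable_csq.
Qed.

Lemma fiber_sum_ge (psi : int -> R -> R[i]) l x : ((csq (psi l x))%:E <= fiber_sum psi x)%E.
Proof.
apply: esum_ge; exists [set l]; first by split.
by rewrite fsbig_set1.
Qed.

End frame_sums.

(** * From integral inequalities to almost everywhere bounds *)

Section frame_bounds.
Context {R : realType}.
Local Notation mu := (@lebesgue_measure R).
Implicit Types (f g : R -> R[i]) (E : set R) (S : R -> \bar R).

Lemma integral_cst_indic E (c : R) : measurable E -> 0 <= c ->
  (\int[mu]_x ((\1_E x)%:E * c%:E) = c%:E * mu E)%E.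
Proof.
move=> mE c0; under eq_integral do rewrite muleC.
rewrite ge0_integralZl_EFin//; last first.
- by apply/measurable_EFinP; exact: measurable_indic.
- by rewrite integral_indic ?setIT.
Qed.

Lemma integral_indic_ge E S (c : R) : measurable E -> measurable_fun [set: R] S ->
  (forall x, (0 <= S x)%E) -> 0 <= c -> (forall x, E x -> (c%:E <= S x)%E) ->
  (c%:E * mu E <= \int[mu]_x ((\1_E x)%:E * S x))%E.
Proof.
move=> mE mS S0 c0 cS; rewrite -integral_cst_indic//.
have mI : measurable_fun [set: R] (fun x : R => (\1_E x)%:E : \bar R).
  by apply/measurable_EFinP; exact: measurable_indic.
apply: ge0_le_integral => //.
- by move=> x _; rewrite -EFinM lee_fin mulr_ge0.
- by apply: emeasurable_funM => //; exact: measurable_cst.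
- exact: emeasurable_funM.
- move=> x _; rewrite indicE; case: (boolP (x \in E)) => [|_]; last by rewrite !mul0e.
  by rewrite inE !mul1e; exact: cS.
Qed.

Lemma integral_indic_le E S (c : R) : measurable E -> measurable_fun [set: R] S ->
  (forall x, (0 <= S x)%E) -> (forall x, E x -> (S x <= c%:E)%E) ->
  (\int[mu]_x ((\1_E x)%:E * S x) <= c%:E * mu E)%E.
Proof.
move=> mE mS S0 cS.
(* The level [c] may be negative, as [alpha / lambda] minus a margin can be; then [E] is empty
   because [S] is nonnegative. *)
have [c0|c0] := leP 0 c; last first.
  have -> : E = set0.
    apply/seteqP; split => // x /cS; apply/negP; rewrite -ltNge.
    by apply: lt_le_trans (S0 x); rewrite lte_fin.
  rewrite measure0 mule0 (@eq_integralT _ _ (cst 0%E)) ?integral0// => x.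
  by rewrite indicE in_set0 mul0e.
rewrite -integral_cst_indic//.
have mI : measurable_fun [set: R] (fun x : R => (\1_E x)%:E : \bar R).
  by apply/measurable_EFinP; exact: measurable_indic.
apply: ge0_le_integral => //.
- by move=> x _; rewrite mule_ge0// lee_fin.
- exact: emeasurable_funM.
- by apply: emeasurable_funM => //; exact: measurable_cst.
- move=> x _; rewrite indicE; case: (boolP (x \in E)) => [|_]; last by rewrite !mul0e.
  by rewrite inE !mul1e; exact: cS.
Qed.

Lemma measure_bounded E (M : R) : measurable E -> E `<=` `[- M, M]%classic ->
  exists2 m : R, 0 <= m & mu E = m%:E.
Proof.
move=> mE EM; have fin : (mu E < +oo)%E.
  apply: (@le_lt_trans _ _ (mu `[- M, M]%classic)).
    by apply: le_measure => //; rewrite inE//; exact: measurable_itv.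
  by rewrite lebesgue_measure_itv; case: ifPn => _; rewrite ?ltry// -EFinB ltry.
by exists (fine (mu E)); [exact: fine_ge0|rewrite fineK// ge0_fin_numE].
Qed.

(** The set where [S] exceeds [b] is a countable union of these sets: the margin [k.+1%:R^-1] makes
    the excess uniform, and the window [[-N, N]] makes the measure finite, so that it can be
    cancelled in real inequalities. *)
Lemma ae_le_of_null_levels S (b : R) :
  (forall (N k : nat), mu ([set x | ((b + k.+1%:R^-1)%:E <= S x)%E] `&`
     `[- N%:R, N%:R]%classic) = 0%E) ->
  measurable_fun [set: R] S -> {ae mu, forall x, (S x <= b%:E)%E}.
Proof.
move=> B0 mS.
have nullP (p : nat * nat) : {ae mu, forall x, ~ ([set x | ((b + p.2.+1%:R^-1)%:E <= S x)%E] `&`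
     `[- p.1%:R, p.1%:R]%classic) x}.
  exists ([set x | ((b + p.2.+1%:R^-1)%:E <= S x)%E] `&` `[- p.1%:R, p.1%:R]%classic); split.
  - apply: measurableI; last exact: measurable_itv.
    rewrite -[X in measurable X]setTI; exact: emeasurable_fun_c_infty.
  - exact: B0.
  - by move=> x /= /contrapT.
apply: ae_imp (ae_forall_count nullP) => x h.
rewrite leNgt; apply/negP => bS.
have [k bk] : exists k : nat, ((b + k.+1%:R^-1)%:E <= S x)%E.
  case: (S x) bS => [s| |]//=; rewrite ?lte_fin => bs; last by exists 0%N; rewrite leey.
  by have [k kb] := ltr_add_invr bs; exists k; rewrite lee_fin ltW.
apply: (h ((Num.truncn `|x|).+1, k)); split => //=.
by rewrite in_itv /= -ler_norml ltW// truncnS_gt.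
Qed.

Lemma ae_ge_of_null_levels S (b : R) :
  (forall (N k : nat), mu ([set x | (S x <= (b - k.+1%:R^-1)%:E)%E] `&`
     `[- N%:R, N%:R]%classic) = 0%E) ->
  measurable_fun [set: R] S -> {ae mu, forall x, (b%:E <= S x)%E}.
Proof.
move=> B0 mS.
have : {ae mu, forall x, (- S x <= (- b)%:E)%E}.
  apply: ae_le_of_null_levels; last exact: measurableT_comp.
  move=> N k; rewrite -(B0 N k); congr (mu (_ `&` _)).
  by apply/seteqP; split => x /=; rewrite leeNr -EFinN opprD opprK.
by apply: ae_imp => x; rewrite EFinN leeN2.
Qed.

End frame_bounds.

(** * Testing the frame inequality; boundedness of the fibers *)

Section frame_characterization.
Context {R : realType}.
Local Notation mu := (@lebesgue_measure R).

(** The transform of the test function is bounded by 1, so its product with the conjugate of [psi l]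
    is square integrable because [psi l] is; Plancherel gives the test function the squared norm
    [mu E]. *)
Lemma frame_indicator (lam alpha beta : R) (phi psi : int -> R -> R[i]) (q : int -> R)
    (E : set R) (M : R) :
  0 < lam -> (forall l, q l = 1 / lam) -> (forall l, inL2 (phi l)) ->
  (forall l, is_fourierL2 (phi l) (psi l)) ->
  (forall l, exists a, {ae mu, forall x, ~ (`[a, a + lam]%classic : set R) x -> psi l x = 0}) ->
  is_nonstationary_frame_of_translates q phi alpha beta ->
  measurable E -> E `<=` `[- M, M]%classic ->
  (alpha%:E * mu E <= lam%:E * \int[mu]_x ((\1_E x)%:E * fiber_sum psi x))%E /\
  (lam%:E * \int[mu]_x ((\1_E x)%:E * fiber_sum psi x) <= beta%:E * mu E)%E.
Proof.
move=> lam0 qE p2 ps psi0 [_ _ _ fr] mE EM.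
have muE : (mu E < +oo)%E by have [m _ ->] := measure_bounded mE EM; rewrite ltry.
have i2 : inL2 (fun x => (\1_E x)%:C : R[i]) by exact: inL2_indic.
have uc : L2c (fun x => (\1_E x)%:C : R[i]).
  split => //; exists M => x Mx; rewrite indicE memNset// => /EM /=.
  by rewrite in_itv /= -ler_norml leNgt Mx.
have csqI x : csq ((\1_E x)%:C : R[i]) = \1_E x.
  by rewrite csq_real indicE; case: (x \in E); rewrite ?expr1n ?expr0n.
have [f f2 fu] := fourierL2_surj_real uc.
have gp2 l : inL2 (fun x => (\1_E x)%:C * (psi l x)^*).
  have [s2 _] := ps l.
  apply: (@inL2M_bounded _ _ 1).
  - exact: cmeasurable_indic.
  - by move=> x; exact: csq_indic_le1.
  - apply: (inL2_le _ (integrable_csq s2)); first exact: cmeasurableJ s2.1.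
    by move=> x; rewrite csqJ.
have := fr f f2; rewrite (frame_sum lam0 qE f2 p2 fu ps gp2 psi0).
have -> : L2normsq f = mu E.
  rewrite L2normsq_nsq// (nsq_fourierL2 f2 fu) -L2normsq_nsq// L2normsqE.
  by under eq_integral do rewrite csqI; rewrite integral_indic ?setIT.
by under eq_integral do rewrite csqI.
Qed.

Lemma inL2_mulJ_ae_bounded g psi (K : R) : inL2 g -> cmeasurable psi -> 0 <= K ->
  {ae mu, forall x, csq (psi x) <= K} -> inL2 (fun x => g x * (psi x)^* : R[i]).
Proof.
move=> g2 mp K0 pK; split; first exact: cmeasurableM g2.1 (cmeasurableJ mp).
rewrite L2normsqE.
apply: (@le_lt_trans _ _ (\int[mu]_x (K%:E * (csq (g x))%:E))%E); last first.
  rewrite ge0_integralZl_EFin//.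
  - by rewrite -L2normsqE L2normsq_nsq// -EFinM ltry.
  - by move=> x _; rewrite lee_fin csq_ge0.
  - by apply/measurable_EFinP; apply: measurable_csq; exact: g2.1.
apply: ae_ge0_le_integral => //.
- by move=> x _; rewrite lee_fin csq_ge0.
- apply/measurable_EFinP; apply: measurable_csq.
  exact: cmeasurableM g2.1 (cmeasurableJ mp).
- by move=> x _; rewrite -EFinM lee_fin mulr_ge0 ?csq_ge0.
- apply: measurable_funeM; apply/measurable_EFinP; apply: measurable_csq; exact: g2.1.
by apply: ae_imp pK => x h _; rewrite -EFinM lee_fin csqM csqJ mulrC ler_wpM2r ?csq_ge0.
Qed.

End frame_characterization.

#[local] Unset Implicit Arguments.

Theorem theorem3p2 (R : realType) (lambda alpha beta : R)
  (lambda_gt0 : 0 < lambda) (alpha_gt0 : 0 < alpha) (beta_gt0 : 0 < beta)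
  (phi : int -> R -> R[i]) (q : int -> R)
  (phi_L2 : forall l, inL2 (phi l))
  (phi_neq0 : forall l, ~ L2zero (phi l))
  (phi_supp : forall l, exists I : interval R,
     (@lebesgue_measure R [set` I] = lambda%:E)%E /\
     ess_support (fourierL2 (phi l)) `<=` [set` I])
  (q_def : forall l, q l = 1 / lambda) :
  is_nonstationary_frame_of_translates q phi alpha beta <->
  {ae @lebesgue_measure R, forall gamma : R,
     ((alpha / lambda)%:E
        <= \esum_(l in [set: int]) ((cmod (fourierL2 (phi l) gamma)) ^+ 2)%:E)%E /\
     (\esum_(l in [set: int]) ((cmod (fourierL2 (phi l) gamma)) ^+ 2)%:E
        <= (beta / lambda)%:E)%E}.
Proof.
pose psi l := fourierL2 (phi l).
have ps l : is_fourierL2 (phi l) (psi l) := fourierL2P (phi_L2 l).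
have s2 l : inL2 (psi l) := (ps l).1.
have psi0 l : exists a, {ae @lebesgue_measure R, forall x,
    ~ (`[a, a + lambda]%classic : set R) x -> psi l x = 0}.
  have [I [muI sI]] := phi_supp l.
  have [a Ia] := itv_sub_segment lambda_gt0 muI.
  by exists a; apply: ess_support_ae0; exact: subset_trans Ia.
have mS : measurable_fun [set: R] (fiber_sum psi).
  by apply: measurable_fiber_sum => l; exact: (s2 l).1.
have sumE x : (\esum_(l in [set: int]) ((cmod (psi l x)) ^+ 2)%:E = fiber_sum psi x)%E.
  by apply: eq_esum => l _; rewrite cmod_sqr.
split=> [fr|bounds].
  have test := @frame_indicator R lambda alpha beta phi psi q _ _
    lambda_gt0 q_def phi_L2 ps psi0 fr.
  have S0 x : (0 <= fiber_sum psi x)%E.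
    by apply: esum_ge0 => l _; rewrite lee_fin csq_ge0.
  have mwin (N : nat) : measurable (`[- N%:R, N%:R]%classic : set R) by exact: measurable_itv.
  have up : {ae @lebesgue_measure R, forall x, (fiber_sum psi x <= (beta / lambda)%:E)%E}.
    apply: ae_le_of_null_levels => // N k; set c := beta / lambda + _.
    set E := _ `&` _.
    have mE : measurable E.
      apply: measurableI => //; rewrite -[X in measurable X]setTI.
      exact: emeasurable_fun_c_infty.
    have EN : E `<=` `[- N%:R, N%:R]%classic by exact: subIsetr.
    have [m m0 mAE] := measure_bounded mE EN.
    have [_] := test _ _ mE EN; rewrite mAE.
    have c0 : 0 <= c by rewrite addr_ge0 ?invr_ge0// divr_ge0// ltW.
    have low := integral_indic_ge mE mS S0 c0 (fun x (Ex : E x) => Ex.1).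
    rewrite mAE -EFinM in low.
    have l0 : (0 <= lambda%:E)%E by rewrite lee_fin ltW.
    move=> /(le_trans (lee_wpmul2l l0 low)); rewrite -!EFinM lee_fin.
    (* The margin in [c] leaves the excess [lambda / k.+1%:R * m], and an inequality with [beta * m]
       on the right then forces [m <= 0]. *)
    have -> : lambda * (c * m) = beta * m + lambda / k.+1%:R * m.
      have : k.+1%:R != 0 :> R by rewrite pnatr_eq0.
      by rewrite /c; move: (k.+1%:R : R) => r r0; field; rewrite r0 gt_eqF.
    rewrite gerDl pmulr_rle0 ?divr_gt0// => m0'; congr EFin.
    by apply/eqP; rewrite eq_le m0' m0.
  have down : {ae @lebesgue_measure R, forall x, ((alpha / lambda)%:E <= fiber_sum psi x)%E}.
    apply: ae_ge_of_null_levels => // N k; set c := alpha / lambda - _.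
    set E := _ `&` _.
    have mE : measurable E.
      apply: measurableI => //; rewrite -[X in measurable X]setTI.
      exact: emeasurable_fun_infty_c.
    have EN : E `<=` `[- N%:R, N%:R]%classic by exact: subIsetr.
    have [m m0 mAE] := measure_bounded mE EN.
    have [+ _] := test _ _ mE EN; rewrite mAE.
    have high := integral_indic_le mE mS S0 (fun x (Ex : E x) => Ex.1).
    rewrite mAE -EFinM in high.
    have l0 : (0 <= lambda%:E)%E by rewrite lee_fin ltW.
    move=> /le_trans /(_ (lee_wpmul2l l0 high)); rewrite -!EFinM lee_fin.
    have -> : lambda * (c * m) = alpha * m - lambda / k.+1%:R * m.
      have : k.+1%:R != 0 :> R by rewrite pnatr_eq0.
      by rewrite /c; move: (k.+1%:R : R) => r r0; field; rewrite r0 gt_eqF.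
    rewrite lerBrDr gerDl pmulr_rle0 ?divr_gt0// => m0'; congr EFin.
    by apply/eqP; rewrite eq_le m0' m0.
  by apply: ae_imp (ae_and up down) => x [h1 h2]; rewrite sumE.
split => //.
- by move=> k; exact: inL2_translate.
- move=> f f2.
  have fg := fourierL2P f2; set g := fourierL2 f in fg.
  have [g2 _] := fg.
  have bl0 : 0 <= beta / lambda by rewrite divr_ge0// ltW.
  (* A single term is at most the fiber sum, so the upper bound makes [psi l] essentially
     bounded. *)
  have gp2 l : inL2 (fun x => g x * (psi l x)^*).
    apply: (inL2_mulJ_ae_bounded g2 (s2 l).1 bl0).
    apply: ae_imp bounds => x [_]; rewrite sumE => h.
    by rewrite -lee_fin; apply: le_trans h; exact: fiber_sum_ge.
  rewrite (frame_sum lambda_gt0 q_def f2 phi_L2 fg ps gp2 psi0).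
  have normE : L2normsq f = (\int[@lebesgue_measure R]_x (csq (g x))%:E)%E.
    by rewrite L2normsq_nsq// (nsq_fourierL2 f2 fg) -L2normsq_nsq// L2normsqE.
  have mg : measurable_fun [set: R] (fun x => (csq (g x))%:E).
    by apply/measurable_EFinP; apply: measurable_csq; exact: g2.1.
  have g0 x : (0 <= (csq (g x))%:E)%E by rewrite lee_fin csq_ge0.
  have S0 x : (0 <= fiber_sum psi x)%E.
    by apply: esum_ge0 => l _; rewrite lee_fin csq_ge0.
  (* By Plancherel, both frame bounds take the shape of the frame sum, with the constant
     [c / lambda] in place of the fiber sum, so that only the integrands remain to be compared. *)
  have scale (c : R) : 0 < c -> (c%:E * L2normsq f =
      lambda%:E * \int[@lebesgue_measure R]_x ((csq (g x))%:E * (c / lambda)%:E))%E.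
    move=> c0; under eq_integral do rewrite muleC.
    rewrite ge0_integralZl_EFin// ?divr_ge0 ?ltW// muleA -EFinM normE.
    by rewrite mulrCA mulfV ?mulr1// gt_eqF.
  have mc (c : R) : measurable_fun [set: R] (fun x => ((csq (g x))%:E * c%:E)%E).
    by apply: emeasurable_funM => //; exact: measurable_cst.
  have l0 : (0 <= lambda%:E)%E by rewrite lee_fin ltW.
  have mgS : measurable_fun [set: R] (fun x => ((csq (g x))%:E * fiber_sum psi x)%E).
    exact: emeasurable_funM.
  have gS0 x : setT x -> (0 <= (csq (g x))%:E * fiber_sum psi x)%E by rewrite mule_ge0.
  have gc0 (c : R) x : 0 < c -> (0 <= (csq (g x))%:E * (c / lambda)%:E)%E.
    by move=> c0; rewrite mule_ge0// lee_fin divr_ge0// ltW.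
  split; rewrite scale//; apply: lee_wpmul2l => //.
  + apply: ae_ge0_le_integral => //; [by move=> x _; exact: gc0|exact: mc|].
    by apply: ae_imp bounds => x [h _] _; rewrite lee_wpmul2l// -sumE.
  + apply: ae_ge0_le_integral => //; [by move=> x _; exact: gc0|exact: mc|].
    by apply: ae_imp bounds => x [_ h] _; rewrite lee_wpmul2l// -sumE.
Qed.
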